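(* The domino problem is undecidable on the long range graph.
   Context: The long range graph is the labelled graph with vertex set $\mathbb Z$ and label set $A=\{t,u\}$, with the following directed edges: for every $n\in\mathbb Z$, an edge labelled $t$ from $n$ to $n+1$; a loop labelled $u$ at $0$; and for all $m\in\mathbb Z$ and $s\in\mathbb N=\{0,1,2,\dots\}$, an edge labelled $u$ from $2^s(2m-1)$ to $2^s(2m+1)$. Domino problem. For a finite set $A$ and an $A$-labelled graph with vertex set $V$ and edge set $E$, where $e\in E$ has tail $e^-$, head $e^+$ and label $\lambda(e)\in A$, the domino problem is the decision problem: given a finite set $B$ and $\Theta\subseteq B\times A\times B$, does there exist $\tau\colon V\to B$ with $(\tau(e^-),\lambda(e),\tau(e^+))\in\Theta$ for all $e\in E$? *)

(* Defs.v *)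
From HB Require Import structures.
From mathcomp Require Import all_boot all_order all_algebra.
Set Implicit Arguments.
Unset Strict Implicit.
Unset Printing Implicit Defensive.

(* The (total) recursive functions nat^k -> nat: the least class containing
   the constant 0 of arity 0, the successor and the projections, closed under
   composition, primitive recursion, and minimization of functions that have
   a zero for every value of the parameters.  The last three clauses describe
   the new function h by its defining equations, so that the class is closed
   under pointwise equality without any appeal to extensionality. *)
Inductive recursive : forall k : nat, (k.-tuple nat -> nat) -> Prop :=
| rec_zero : recursive (fun _ : 0.-tuple nat => 0)
| rec_succ : recursive (fun v : 1.-tuple nat => (thead v).+1)
| rec_proj (k : nat) (i : 'I_k) :
    recursive (fun v : k.-tuple nat => tnth v i)
| rec_comp (m k : nat) (f : m.-tuple nat -> nat)
    (g : 'I_m -> k.-tuple nat -> nat) (h : k.-tuple nat -> nat) :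
    recursive f -> (forall i, recursive (g i)) ->
    (forall v, h v = f [tuple g i v | i < m]) ->
    recursive h
| rec_prec (k : nat) (f : k.-tuple nat -> nat) (g : k.+2.-tuple nat -> nat)
    (h : k.+1.-tuple nat -> nat) :
    recursive f -> recursive g ->
    (forall v : k.-tuple nat, h [tuple of 0 :: v] = f v) ->
    (forall (n : nat) (v : k.-tuple nat),
      h [tuple of n.+1 :: v] = g [tuple of n :: h [tuple of n :: v] :: v]) ->
    recursive h
| rec_mu (k : nat) (f : k.+1.-tuple nat -> nat) (h : k.-tuple nat -> nat) :
    recursive f ->
    (forall v : k.-tuple nat, f [tuple of h v :: v] = 0) ->
    (forall (v : k.-tuple nat) (n : nat), n < h v -> f [tuple of n :: v] <> 0) ->
    recursive h.

(* [code] presents the instances x : I to an algorithm as natural numbers; the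
   algorithm must answer 1 or 0 according to whether P x holds. *)
Definition decidable_problem (I : Type) (code : I -> nat) (P : I -> Prop)
  : Prop :=
  exists f : 1.-tuple nat -> nat,
    recursive f /\
    forall x : I, (P x -> f [tuple code x] = 1) /\
                  (~ P x -> f [tuple code x] = 0).

Record lgraph (A : finType) : Type := LGraph {
  vertex : Type;
  edge : Type;
  edge_tail : edge -> vertex;
  edge_head : edge -> vertex;
  edge_label : edge -> A
}.

Definition tileable (A : finType) (G : lgraph A) (B : finType)
    (Theta : {set B * A * B}) : Prop :=
  exists tau : vertex G -> B,
    forall e : edge G, (tau (edge_tail e), edge_label e, tau (edge_head e)) \in Theta.

(* An instance of the domino problem as a finite object: B = {0, ..., n-1} and
   Theta is given by listing its elements, in any order and possibly with
   repetitions. *)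
Record domino_instance (A : finType) : Type := DominoInstance {
  colours : nat;
  triples : seq ('I_colours * A * 'I_colours)
}.

(* The instance with triples (b1,a1,c1), (b2,a2,c2), ... is written as the word
   n b1 a1 c1 b2 a2 c2 ... over nat, labels being numbered along [enum A];
   [CodeSeq.code] is the effective bijection
   x :: s |-> 2 ^ x * (2 * code s + 1) from words over nat to nat. *)
Definition domino_code (A : finType) (x : domino_instance A) : nat :=
  CodeSeq.code (colours x ::
    flatten [seq [:: val p.1.1; val (enum_rank p.1.2); val p.2]
            | p <- triples x]).

Definition domino_decidable (A : finType) (G : lgraph A) : Prop :=
  decidable_problem (@domino_code A)
    (fun x => tileable G [set p in triples x]).

Inductive tu : Type := label_t | label_u.

Definition bool_of_tu (a : tu) : bool := if a is label_t then true else false.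
Definition tu_of_bool (b : bool) : tu := if b then label_t else label_u.
Lemma bool_of_tuK : cancel bool_of_tu tu_of_bool. Proof. by case. Qed.

HB.instance Definition _ := Finite.copy tu (can_type bool_of_tuK).

Inductive long_range_edge : Type :=
| edge_t of int
| loop_u
| edge_u of int & nat.

Section LongRange.
Local Open Scope ring_scope.

Definition long_range_tail (e : long_range_edge) : int :=
  match e with
  | edge_t n => n
  | loop_u => 0
  | edge_u m s => 2 ^+ s * (2 * m - 1)
  end.

Definition long_range_head (e : long_range_edge) : int :=
  match e with
  | edge_t n => n + 1
  | loop_u => 0
  | edge_u m s => 2 ^+ s * (2 * m + 1)
  end.

Definition long_range_label (e : long_range_edge) : tu :=
  if e is edge_t _ then label_t else label_u.

Definition long_range_graph : lgraph tu :=
  LGraph long_range_tail long_range_head long_range_label.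
End LongRange.

(* Main.v *)
Require Import Defs.
From mathcomp Require Import all_boot all_order all_algebra.
From mathcomp Require Import zify ring.
Set Implicit Arguments.
Unset Strict Implicit.
Unset Printing Implicit Defensive.

(** The long range graph contains a quarter-plane grid that its colourings can
    be made to recognise, and on that grid a colouring can be forced to spell
    out a computation.

    The grid.  Vertex 0 is the only vertex with a loop labelled u, so a set of
    triples in which a single colour B may follow itself along u forces 0 to
    have colour B.  (Residues mod 3 keep other u-neighbours of one sign apart,
    since 2^(s+1) is never divisible by 3.)  Along the t-line, B separates
    negative from positive vertices.  A positive vertex is a power of 2 exactly
    when the u-edge entering it comes from a negative vertex.  Powers of 2 cut the positive vertices into columns [2^i, 2^(i+1)[,
    and the parity of i is a local information: it flips at powers of 2.  The
    other vertices whose u-predecessor lies in another column are exactly the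
    2^i + 2^j with j < i, and the column changes by one (column_upred).  Hence
    these cells (i, j) are locally recognisable.  The t-line visits the cells of
    column i in the order j = 0, ..., i - 1 before it passes to column i + 1,
    and the u-line of level j links the cell (i, j) to the cell (i + 1, j).  A
    colour carries a state along the t-line and a letter along the u-line;
    both are passed on unchanged except at the cells, where they may interact,
    and at the powers of 2.

    The machine.  What the grid computes is an iterated transducer: a tape
    whose cell j holds a letter, and a finite automaton that in round i reads
    and rewrites the cells j < i from left to right, and keeps its state for
    the next round.  The colouring of the positive vertices is determined by
    the run (coloured_run), and exists unless the run meets a forbidden state
    (run_colours).  Transducers simulate counter machines, a counter being the
    number of tape letters that contain a given mark; in one round one counter
    is incremented, or decremented, or found to be zero.  Every recursive
    function is computed by a structured counter program
    (recursive_computable), so for every recursive d there is a transducer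
    which on input x enters a forbidden state if and only if d x <> 0
    (transducer_decides).

    The input.  The u-predecessor of 2^s is -2^s.  If the vertices 0, -1, ...,
    -2^x carry pairwise different colours and the vertices beyond them do not,
    then 2^s can see locally whether s <= x, and the tape starts with x + 1
    non-blank letters.

    The diagonal argument.  Let the program of a transducer be its list of
    triples, and feed it with the code x of that very list: the extra triples
    for the input x can be prepended to the list by a recursive operation on
    codes (recursive_chain_code), because they only involve x and colour
    numbers chosen so that the relevant colours are visible mod 4.  If f
    decided the domino problem, take the transducer for d x = f (code of the
    resulting instance).  Fed with its own code, it avoids forbidden states
    exactly when f answers 0, that is, when the instance cannot be coloured;
    but it avoids forbidden states exactly when the instance can. *)

(** * Closure properties of the recursive functions *)

Lemma recursive_ext k (f h : k.-tuple nat -> nat) :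
  recursive f -> f =1 h -> recursive h.
Proof.
move=> rf fh; apply: (rec_comp rf (fun i => rec_proj i)) => v.
by rewrite -fh; congr f; apply: eq_from_tnth => i; rewrite tnth_mktuple.
Qed.

Lemma recursive_head k : recursive (fun v : k.+1.-tuple nat => thead v).
Proof. exact: rec_proj ord0. Qed.

Lemma recursive_behead k (f : k.-tuple nat -> nat) :
  recursive f -> recursive (fun v : k.+1.-tuple nat => f (behead_tuple v)).
Proof.
move=> rf; apply: (rec_comp rf (fun i => rec_proj (lift ord0 i))) => v.
congr f; apply: eq_from_tnth => i; rewrite tnth_mktuple tnth_behead.
by congr tnth; apply: val_inj; rewrite /= inordK // ltnS.
Qed.

Lemma recursive_app1 k (f : nat -> nat) (F : k.-tuple nat -> nat) :
  recursive (fun v : 1.-tuple nat => f (thead v)) -> recursive F ->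
  recursive (fun v => f (F v)).
Proof. by move=> rf rF; apply: (rec_comp rf (fun _ => rF)) => v; rewrite /thead tnth_mktuple. Qed.

Lemma recursive_S k (F : k.-tuple nat -> nat) :
  recursive F -> recursive (fun v => (F v).+1).
Proof. exact: recursive_app1 rec_succ. Qed.

Lemma recursive_const k n : recursive (fun _ : k.-tuple nat => n).
Proof.
elim: n => [|n]; last exact: recursive_S.
by apply: (rec_comp (g := fun i : 'I_0 => fun _ => 0) rec_zero) => // -[].
Qed.

(** Primitive recursion in the form of a loop whose body may refer to the loop
    index, the accumulator and the ambient parameters: this form nests, each
    loop adding two variables in front of the environment. *)
Lemma recursive_iteri k (n base : k.-tuple nat -> nat)
    (step : nat -> nat -> k.-tuple nat -> nat) :
  recursive n -> recursive base ->
  recursive (fun w : k.+2.-tuple nat =>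
    step (thead w) (thead (behead_tuple w)) (behead_tuple (behead_tuple w))) ->
  recursive (fun v => iteri (n v) (fun i acc => step i acc v) (base v)).
Proof.
move=> rn rb rs.
have bhK (x : nat) (v : k.-tuple nat) : behead_tuple [tuple of x :: v] = v.
  exact: val_inj.
pose h (w : k.+1.-tuple nat) := iteri (thead w)
  (fun i acc => step i acc (behead_tuple w)) (base (behead_tuple w)).
have rh : recursive h.
  apply: (rec_prec rb rs) => [v|i v]; rewrite /h theadE /= !bhK //=.
  congr step; apply: val_inj => //=.
pose g (i : 'I_k.+1) (v : k.-tuple nat) :=
  if unlift ord0 i is Some j then tnth v j else n v.
have rg i : recursive (g i).
  by rewrite /g; case: unliftP => [j|] _; [exact: rec_proj|].
apply: (rec_comp rh rg) => v.
set w := mktuple _; have -> : w = [tuple of n v :: v].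
  apply: eq_from_tnth => i; rewrite tnth_mktuple /g.
  by case: unliftP => [j|] ->; rewrite ?tnth0 // tnthS.
by rewrite /h theadE bhK.
Qed.

Lemma recursive_add k (F G : k.-tuple nat -> nat) :
  recursive F -> recursive G -> recursive (fun v => F v + G v).
Proof.
move=> rF rG.
apply: (recursive_ext (recursive_iteri (step := fun _ acc _ => acc.+1) rG rF _)).
  exact: recursive_S (recursive_behead (recursive_head _)).
by move=> v /=; elim: (G v) => [|m IH] /=; rewrite ?addn0 // IH addnS.
Qed.

Lemma recursive_mul k (F G : k.-tuple nat -> nat) :
  recursive F -> recursive G -> recursive (fun v => F v * G v).
Proof.
move=> rF rG.
apply: (recursive_ext (recursive_iteri (step := fun _ acc v => acc + F v) rG
  (recursive_const _ 0) _)).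
  apply: recursive_add; first exact: recursive_behead (recursive_head _).
  exact: recursive_behead (recursive_behead rF).
by move=> v /=; elim: (G v) => [|m IH] /=; rewrite ?muln0 // IH mulnS addnC.
Qed.

Lemma recursive_exp2 k (F : k.-tuple nat -> nat) :
  recursive F -> recursive (fun v => 2 ^ F v).
Proof.
move=> rF.
apply: (recursive_ext (recursive_iteri (step := fun _ acc _ => 2 * acc) rF
  (recursive_const _ 1) _)).
  apply: recursive_mul (recursive_const _ _) _.
  exact: recursive_behead (recursive_head _).
by move=> v /=; elim: (F v) => [|m IH] //=; rewrite IH expnS.
Qed.

(** * Counter programs compute the recursive functions *)

(** [Loop r c] decrements [r] and runs [c] as long as [r] is not 0; the body is
    free to change [r]. *)
Inductive program : Type :=
| Inc of nat
| Dec of nat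
| Seq of program & program
| Loop of nat & program.

Definition update (m : nat -> nat) (r x : nat) : nat -> nat :=
  fun r' => if r' == r then x else m r'.

Lemma update_eq m r x : update m r x r = x.
Proof. by rewrite /update eqxx. Qed.

Lemma update_neq m r x r' : r' != r -> update m r x r' = m r'.
Proof. by rewrite /update => /negPf ->. Qed.

Inductive exec : program -> (nat -> nat) -> (nat -> nat) -> Prop :=
| exec_Inc r m : exec (Inc r) m (update m r (m r).+1)
| exec_Dec r m : exec (Dec r) m (update m r (m r).-1)
| exec_Seq c1 c2 m1 m2 m3 :
    exec c1 m1 m2 -> exec c2 m2 m3 -> exec (Seq c1 c2) m1 m3
| exec_Loop_end r c m : m r = 0 -> exec (Loop r c) m m
| exec_Loop_step r c m1 m2 m3 :
    m1 r <> 0 -> exec c (update m1 r (m1 r).-1) m2 -> exec (Loop r c) m2 m3 ->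
    exec (Loop r c) m1 m3.

Definition clear r := Loop r (Dec r).

(** Each turn of [clear r] decrements [r] twice, once in the test and once in
    the body. *)
Lemma exec_clear r m :
  exists m', [/\ exec (clear r) m m', m' r = 0
              & forall s, s != r -> m' s = m s].
Proof.
have [n le_n] := ubnP (m r); elim: n m le_n => // n IHn m le_n.
have [m0|mn0] := eqVneq (m r) 0.
  by exists m; split=> //; apply: exec_Loop_end.
pose m1 := update m r (m r).-1; pose m2 := update m1 r (m1 r).-1.
have [|m' [e0 m'0 m's]] := IHn m2.
  rewrite /m2 /m1 !update_eq; lia.
exists m'; split=> // [|s sr].
  by apply: exec_Loop_step e0; [apply/eqP | apply: exec_Dec].
by rewrite m's // /m2 /m1 !update_neq.
Qed.

Definition copy src dst tmp :=
  Seq (Seq (clear dst) (clear tmp))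
      (Seq (Loop src (Seq (Inc dst) (Inc tmp))) (Loop tmp (Inc src))).

Lemma exec_copy src dst tmp m :
  src != dst -> src != tmp -> dst != tmp ->
  exists m', [/\ exec (copy src dst tmp) m m', m' dst = m src
    & forall s, s != dst -> s != tmp -> m' s = m s].
Proof.
move=> sd st dt.
have [m1 [e1 m1d m1o]] := exec_clear dst m.
have [m2 [e2 m2t m2o]] := exec_clear tmp m1.
have [m3 [e3 m3s m3d m3t m3o]] : exists m3,
    [/\ exec (Loop src (Seq (Inc dst) (Inc tmp))) m2 m3, m3 src = 0,
        m3 dst = m2 dst + m2 src, m3 tmp = m2 tmp + m2 src &
        forall s, s != src -> s != dst -> s != tmp -> m3 s = m2 s].
  elim: {e2 m2t m2o}(m2 src) {-2}m2 (erefl (m2 src)) => [|n IHn] m0 m0s.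
    by exists m0; split; rewrite ?m0s ?addn0 //; apply: exec_Loop_end.
  pose m1' := update m0 src n; pose m2' := update m1' dst (m1' dst).+1.
  pose m3' := update m2' tmp (m2' tmp).+1.
  have src3 : m3' src = n by rewrite /m3' /m2' /m1' 2?update_neq ?update_eq.
  have [//|m' [e0 q1 q2 q3 q4]] := IHn m3'.
  exists m'; split=> // [|||s s1 s2 s3].
  - apply: exec_Loop_step e0; first by rewrite m0s.
    by rewrite m0s; apply: exec_Seq; apply: exec_Inc.
  - rewrite q2 src3 m0s -addSnnS /m3' /m2' /m1' update_neq // update_eq.
    by rewrite update_neq // eq_sym.
  - rewrite q3 src3 m0s -addSnnS /m3' /m2' /m1' update_eq.
    by rewrite !update_neq // eq_sym.
  - by rewrite q4 // /m3' /m2' /m1' !update_neq.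
have [m4 [e4 m4t m4s m4o]] : exists m4,
    [/\ exec (Loop tmp (Inc src)) m3 m4, m4 tmp = 0,
        m4 src = m3 src + m3 tmp & forall s, s != src -> s != tmp -> m4 s = m3 s].
  elim: {e3 m3s m3d m3t m3o}(m3 tmp) {-2}m3 (erefl (m3 tmp)) => [|n IHn] m0 m0s.
    by exists m0; split; rewrite ?m0s ?addn0 //; apply: exec_Loop_end.
  pose m1' := update m0 tmp n; pose m2' := update m1' src (m1' src).+1.
  have tmp2 : m2' tmp = n by rewrite /m2' /m1' update_neq 1?eq_sym // update_eq.
  have [//|m' [e0 q1 q2 q3]] := IHn m2'.
  exists m'; split=> // [||s s1 s2].
  - by apply: exec_Loop_step e0; rewrite m0s //; apply: exec_Inc.
  - by rewrite q2 tmp2 m0s -addSnnS /m2' /m1' update_eq update_neq.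
  - by rewrite q3 // /m2' /m1' !update_neq.
have m2s : m2 src = m src by rewrite m2o // m1o.
exists m4; split=> [||s s1 s2].
- exact: exec_Seq (exec_Seq e1 e2) (exec_Seq e3 e4).
- have -> : m4 dst = m3 dst by apply: m4o; rewrite // eq_sym.
  by rewrite m3d m2s m2o // m1d.
- have [->|ss] := eqVneq s src; last by rewrite m4o // m3o // m2o // m1o.
  by rewrite m4s m3s m3t m2t m2s.
Qed.

(** Arguments are read in the registers [a], the result is left in [o], and
    registers from [b] on are scratch space of arbitrary contents.  The program
    depends on the choice of registers, so that programs can be combined without
    ever relocating them; the arguments survive, so that they can be used
    again. *)
Definition computable k (f : k.-tuple nat -> nat) : Prop :=
  forall (a : k.-tuple nat) (o b : nat),
    {in a, forall r, r < b} -> o < b -> o \notin a ->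
  exists c, forall m, exists m',
    [/\ exec c m m', m' o = f (map_tuple m a)
     & forall r, r < b -> r != o -> m' r = m r].

Lemma computable_zero : computable (fun _ : 0.-tuple nat => 0).
Proof.
move=> a o b _ ob _; exists (clear o) => m.
by have [m' [e m'0 m's]] := exec_clear o m; exists m'; split=> // r _ /m's.
Qed.

Lemma computable_proj k (i : 'I_k) :
  computable (fun v : k.-tuple nat => tnth v i).
Proof.
move=> a o b ab ob oa; exists (copy (tnth a i) o b) => m.
have tb : tnth a i < b by apply: ab; apply: mem_tnth.
have [|||m' [e m'o m's]] := @exec_copy (tnth a i) o b m.
- by apply: contraNneq oa => <-; apply: mem_tnth.
- by rewrite neq_ltn tb.
- by rewrite neq_ltn ob.
exists m'; split=> // [|r rb ro]; first by rewrite m'o tnth_map.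
by rewrite m's // neq_ltn rb.
Qed.

Lemma computable_succ : computable (fun v : 1.-tuple nat => (thead v).+1).
Proof.
move=> a o b ab ob oa.
have [c Hc] := @computable_proj 1 ord0 a o b ab ob oa.
exists (Seq c (Inc o)) => m; have [m' [e m'o m's]] := Hc m.
exists (update m' o (m' o).+1); split=> [||r rb ro].
- exact: exec_Seq e (exec_Inc _ _).
- by rewrite update_eq m'o.
- by rewrite update_neq // m's.
Qed.

Lemma map_tuple_agree k (a : k.-tuple nat) (m m' : nat -> nat) :
  {in a, m =1 m'} -> map_tuple m a = map_tuple m' a.
Proof. by move=> mm'; apply: val_inj; apply/eq_in_map. Qed.

(** The values of the [g i] go to the registers [b], ..., [b + m - 1], and the
    scratch space moves up accordingly. *)
Lemma computable_comp m k (f : m.-tuple nat -> nat)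
    (g : 'I_m -> k.-tuple nat -> nat) (h : k.-tuple nat -> nat) :
  computable f -> (forall i, computable (g i)) ->
  (forall v, h v = f [tuple g i v | i < m]) -> computable h.
Proof.
move=> cf cg hE a o b ab ob oa.
have ab' : {in a, forall r, r < b + m} by move=> r /ab; lia.
have [cs Hcs] : exists c, forall M, exists M', [/\ exec c M M',
    forall i : 'I_m, i < m -> M' (b + i) = g i (map_tuple M a)
    & forall r, r < b -> M' r = M r].
  suff Hle n : n <= m -> exists c, forall M, exists M', [/\ exec c M M',
      forall i : 'I_m, i < n -> M' (b + i) = g i (map_tuple M a)
      & forall r, r < b -> M' r = M r] by exact: Hle.
  elim: n => [|j IHj] lejm.
    (* There is no empty program; decrementing a scratch register does nothing
       that matters. *)
    exists (Dec b) => M; exists (update M b (M b).-1); split=> // [|r rb].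
      exact: exec_Dec.
    by rewrite update_neq // neq_ltn rb.
  have [c Hc] := IHj (ltnW lejm); pose i0 := Ordinal lejm.
  have [||c' Hc'] := cg i0 a (b + j) (b + m) ab'; first by lia.
    by apply/negP => /ab; lia.
  exists (Seq c c') => M; have [M1 [e1 M1g M1o]] := Hc M.
  have [M2 [e2 M2g M2o]] := Hc' M1; exists M2; split=> [|i|r rb].
  - exact: exec_Seq e1 e2.
  - have M1a : map_tuple M1 a = map_tuple M a.
      by apply: map_tuple_agree => r /ab; apply: M1o.
    rewrite ltnS leq_eqVlt => /orP[/eqP ij|ij].
      by rewrite ij M2g M1a (_ : i0 = i) //; apply: val_inj.
    rewrite M2o ?M1g ?ltn_add2l //.
    by rewrite eqn_add2l neq_ltn ij.
  - by rewrite M2o ?M1o //; lia.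
pose a' := [tuple b + i | i < m].
have [|||c Hc] := cf a' o (b + m).
- by move=> r /mapP[i _ ->]; rewrite ltn_add2l.
- by lia.
- by apply/negP => /mapP[i _ ?]; lia.
exists (Seq cs c) => M; have [M1 [e1 M1g M1o]] := Hcs M.
have [M2 [e2 M2g M2o]] := Hc M1; exists M2; split=> [||r rb ro].
- exact: exec_Seq e1 e2.
- rewrite M2g hE; congr f; apply: eq_from_tnth => i.
  by rewrite tnth_map !tnth_mktuple M1g.
- by rewrite M2o ?M1o //; lia.
Qed.

Lemma computable_prec k (f : k.-tuple nat -> nat) (g : k.+2.-tuple nat -> nat)
    (h : k.+1.-tuple nat -> nat) :
  computable f -> computable g ->
  (forall v : k.-tuple nat, h [tuple of 0 :: v] = f v) ->
  (forall (n : nat) (v : k.-tuple nat),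
    h [tuple of n.+1 :: v] = g [tuple of n :: h [tuple of n :: v] :: v]) ->
  computable h.
Proof.
move=> cf cg h0 hS a o b; case/tupleP: a => a0 a ab ob oa.
have a0b : a0 < b by apply: ab; rewrite inE eqxx.
have {}ab : {in a, forall r, r < b} by move=> r ra; apply: ab; rewrite inE ra orbT.
(* Scratch registers: the recursion index, the value reached, the number of
   steps left, and the next value, which must not overwrite acc while it is
   being computed from it *)
pose cnt := b; pose acc := b.+1; pose rem := b.+2; pose new := b.+3.
pose b' := b.+4.
have [|||cF HF] := cf a acc b'; rewrite ?/b' ?/acc; try lia.
- by move=> r /ab; lia.
- by apply/negP => /ab; lia.
have [|||cG HG] := cg [tuple of cnt :: acc :: a] new b';
    rewrite ?/b' ?/new ?/cnt ?/acc; try lia.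
- by move=> r; rewrite !inE => /or3P[/eqP->|/eqP->|/ab]; lia.
- by rewrite !inE; apply/negP => /or3P[/eqP|/eqP|/ab]; lia.
rewrite -/cnt -/acc -/new -/b' in HF HG.
pose body := Seq cG (Seq (copy new acc b') (Inc cnt)).
exists (Seq (Seq (copy a0 rem b') (clear cnt)) (Seq cF (Seq (Loop rem body)
  (copy acc o b')))) => m.
have [|||m1 [e1 m1r m1o]] := @exec_copy a0 rem b' m; rewrite ?/rem ?/b'; try lia.
have [m2 [e2 m2c m2o]] := exec_clear cnt m1.
have [m3 [e3 m3a m3o]] := HF m2.
pose v := map_tuple m a.
have low1 r : r < b -> m1 r = m r by move=> ?; rewrite m1o //; lia.
have low2 r : r < b -> m2 r = m r by move=> ?; rewrite m2o ?low1 //; lia.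
have low3 r : r < b -> m3 r = m r by move=> ?; rewrite m3o ?low2 //; lia.
have [m4 [e4 m4a m4o]] : exists m4, [/\ exec (Loop rem body) m3 m4,
    m4 acc = h [tuple of m3 cnt + m3 rem :: v]
    & forall r, r < b -> m4 r = m3 r].
  suff loop n M : M rem = n -> M acc = h [tuple of M cnt :: v] ->
      map_tuple M a = v -> exists M', [/\ exec (Loop rem body) M M',
        M' acc = h [tuple of M cnt + n :: v] & forall r, r < b -> M' r = M r].
    apply: loop => //.
      rewrite m3a m3o ?m2c ?h0; try lia.
      by congr f; apply: map_tuple_agree => r /ab; apply: low2.
    by apply: map_tuple_agree => r /ab; apply: low3.
  elim: n M => [|n IHn] M Mr inv0 inv1.
    by exists M; split; rewrite ?addn0 //; apply: exec_Loop_end.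
  pose M1 := update M rem n.
  have [M2 [d2 M2n M2o]] := HG M1.
  have [|||M3 [d3 M3a M3o]] := @exec_copy new acc b' M2; rewrite ?/new ?/acc ?/b';
    try lia.
  pose M4 := update M3 cnt (M3 cnt).+1.
  have lowM r : r < b -> M4 r = M r.
    move=> rb; rewrite /M4 update_neq ?M3o ?M2o /M1 ?update_neq //; lia.
  have M1c : M1 cnt = M cnt by rewrite /M1 update_neq //; lia.
  have M4c : M4 cnt = (M cnt).+1.
    by rewrite /M4 update_eq M3o ?M2o ?M1c //; lia.
  have M4r : M4 rem = n.
    by rewrite /M4 update_neq ?M3o ?M2o /M1 ?update_eq //; lia.
  have [|||M5 [d5 M5a M5o]] := IHn M4.
  - exact: M4r.
  - rewrite M4c hS /M4 update_neq; last by lia.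
    rewrite M3a M2n; congr g; apply: val_inj => /=; rewrite M1c.
    congr [:: _, _ & _].
      by rewrite -inv0 /M1 update_neq //; lia.
    have <- : map M a = v by rewrite -inv1.
    by apply/eq_in_map => r /ab rb; rewrite /M1 update_neq //; lia.
  - by rewrite -inv1; apply: map_tuple_agree => r /ab; apply: lowM.
  exists M5; split=> [||r rb].
  - apply: exec_Loop_step d5; rewrite Mr //.
    exact: exec_Seq d2 (exec_Seq d3 (exec_Inc _ _)).
  - by rewrite M5a M4c addSnnS.
  - by rewrite M5o ?lowM.
have [|||m5 [e5 m5o m5r]] := @exec_copy acc o b' m4; rewrite ?/acc ?/b'; try lia.
exists m5; split=> [||r rb ro].
- exact: exec_Seq (exec_Seq e1 e2) (exec_Seq e3 (exec_Seq e4 e5)).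
- rewrite m5o m4a; congr h; apply: val_inj => /=; congr (_ :: _).
  rewrite m3o; try lia.
  rewrite m2c m3o; try lia.
  by rewrite m2o ?m1r //; lia.
- by rewrite m5r ?m4o ?low3 //; lia.
Qed.

Lemma computable_mu k (f : k.+1.-tuple nat -> nat) (h : k.-tuple nat -> nat) :
  computable f ->
  (forall v : k.-tuple nat, f [tuple of h v :: v] = 0) ->
  (forall (v : k.-tuple nat) (n : nat), n < h v -> f [tuple of n :: v] <> 0) ->
  computable h.
Proof.
move=> cf h0 hlt a o b ab ob oa.
pose cnt := b; pose val := b.+1; pose b' := b.+2.
have [|||cF HF] := cf [tuple of cnt :: a] val b'; rewrite ?/b' ?/val ?/cnt;
  try lia.
- by move=> r; rewrite !inE => /orP[/eqP->|/ab]; lia.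
- by rewrite !inE; apply/negP => /orP[/eqP|/ab]; lia.
rewrite -/cnt -/val -/b' in HF.
exists (Seq (clear cnt) (Seq (Seq cF (Loop val (Seq (Inc cnt) cF)))
  (copy cnt o b'))) => m.
have [m1 [e1 m1c m1o]] := exec_clear cnt m.
pose v := map_tuple m a.
have fE M : (forall r, r < b -> M r = m r) ->
    f (map_tuple M [tuple of cnt :: a]) = f [tuple of M cnt :: v].
  move=> Mm; congr f; apply: val_inj => /=; congr (_ :: _).
  by apply/eq_in_map => r /ab; apply: Mm.
have low1 r : r < b -> m1 r = m r by move=> ?; rewrite m1o //; lia.
have [m2 [e2 m2v m2o]] := HF m1; rewrite fE // in m2v.
have low2 r : r < b -> m2 r = m r by move=> ?; rewrite m2o ?low1 //; lia.
have m2c : m2 cnt = 0 by rewrite m2o ?m1c //; lia.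
have [m3 [e3 m3c m3o]] : exists m3, [/\ exec (Loop val (Seq (Inc cnt) cF)) m2 m3,
    m3 cnt = h v & forall r, r < b -> m3 r = m r].
  suff loop n M : h v - M cnt = n -> (forall r, r < b -> M r = m r) ->
      M val = f [tuple of M cnt :: v] -> M cnt <= h v ->
      exists M', [/\ exec (Loop val (Seq (Inc cnt) cF)) M M',
        M' cnt = h v & forall r, r < b -> M' r = m r].
    by apply: loop (erefl _) _ _ _; rewrite // ?m2c // m2v m1c.
  elim: n M => [|n IHn] M Mn low inv le.
    have Mc : M cnt = h v by lia.
    by exists M; split=> //; apply: exec_Loop_end; rewrite inv Mc.
  have Mlt : M cnt < h v by lia.
  pose M1 := update M val (M val).-1; pose M2 := update M1 cnt (M1 cnt).+1.
  have [M3 [d3 M3v M3o]] := HF M2.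
  have lowM2 r : r < b -> M2 r = m r.
    by move=> rb; rewrite /M2 /M1 !update_neq ?low //; lia.
  rewrite fE // in M3v.
  have M2c : M2 cnt = (M cnt).+1 by rewrite /M2 update_eq /M1 update_neq //; lia.
  have M3c : M3 cnt = (M cnt).+1 by rewrite M3o ?M2c //; lia.
  have [||||M4 [d4 M4c M4o]] := IHn M3.
  - lia.
  - by move=> r rb; rewrite M3o ?lowM2 //; lia.
  - by rewrite M3v M3c M2c.
  - by lia.
  exists M4; split=> //; apply: exec_Loop_step d4.
    by rewrite inv; apply: hlt.
  exact: exec_Seq (exec_Inc _ _) d3.
have [|||m4 [e4 m4c m4o]] := @exec_copy cnt o b' m3; rewrite ?/cnt ?/b'; try lia.
exists m4; split=> [||r rb ro].
- exact: exec_Seq e1 (exec_Seq (exec_Seq e2 e3) e4).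
- by rewrite m4c m3c.
- by rewrite m4o ?m3o //; lia.
Qed.

Theorem recursive_computable k (f : k.-tuple nat -> nat) :
  recursive f -> computable f.
Proof.
elim=> {k f} => [||k i|m k f g h _ cf _ cg hE|k f g h _ cf _ cg h0 hS|k f h _ cf h0 hlt].
- exact: computable_zero.
- exact: computable_succ.
- exact: computable_proj.
- exact: computable_comp cf cg hE.
- exact: computable_prec cf cg h0 hS.
- exact: computable_mu cf h0 hlt.
Qed.

(** * Iterated transducers and their simulation of counter programs *)

(** [delta] acts on a tape cell, [gamma] between two rounds.  The tape starts
    with some copies of [unit_letter] followed by [blank]s. *)
Record transducer : Type := Transducer {
  state : finType;
  letter : finType;
  delta : state -> letter -> state * letter;
  gamma : state -> state;
  start : state;
  blank : letter;
  unit_letter : letter;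
  bad : pred state
}.

Definition initial (M : transducer) (x j : nat) : letter M :=
  if j < x then unit_letter M else blank M.

Fixpoint scan (M : transducer) (w : nat -> letter M) (q : state M) (j : nat) :=
  if j is j'.+1 then (delta (scan w q j') (w j')).1 else q.

(** Round [i] treats the cells below [i] only, as column [i] of the graph has
    only [i] cells.  The state in [config M x i] is the one that ends round
    [i - 1]: [gamma] has still to be applied to it. *)
Fixpoint config (M : transducer) (x i : nat) : state M * (nat -> letter M) :=
  if i is i'.+1 then
    let: (q, w) := config M x i' in
    (scan w (gamma q) i',
     fun j => if j < i' then (delta (scan w (gamma q) j) (w j)).2 else w j)
  else (start M, initial M x).

Definition entering M x i : state M := (config M x i).1.
Definition tape M x i : nat -> letter M := (config M x i).2.

Lemma enteringS M x i :
  entering M x i.+1 = scan (tape M x i) (gamma (entering M x i)) i.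
Proof. by rewrite /entering /tape /=; case: config. Qed.

Lemma tapeS M x i j : tape M x i.+1 j =
  if j < i
  then (delta (scan (tape M x i) (gamma (entering M x i)) j) (tape M x i j)).2
  else tape M x i j.
Proof. by rewrite /entering /tape /=; case: config. Qed.

Lemma tape_initial M x i j : i <= j.+1 -> tape M x i j = initial M x j.
Proof.
elim: i => [|i IHi] // lt_ij; rewrite tapeS ltnNge -ltnS lt_ij /=.
by apply: IHi; rewrite ltnW.
Qed.

Lemma scan_idle M (w : nat -> letter M) q i :
  (forall j, j < i -> delta q (w j) = (q, w j)) ->
  forall j, j <= i -> scan w q j = q.
Proof.
by move=> idle; elim=> [|j IHj] //= lt_ji; rewrite IHj ?idle // ltnW.
Qed.

Lemma column_idle M x i q : gamma (entering M x i) = q ->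
  (forall j, j < i -> delta q (tape M x i j) = (q, tape M x i j)) ->
  entering M x i.+1 = q /\ tape M x i.+1 =1 tape M x i.
Proof.
move=> gq idle; have scq := scan_idle idle.
split=> [|j]; first by rewrite enteringS gq scq.
by rewrite tapeS gq; case: ifP => // ltji; rewrite scq ?idle // ltnW.
Qed.

(** The pattern of all useful rounds: the state [q] looks for the first cell
    that it does not leave alone, and then has nothing more to do. *)
Lemma column_hit M x i q q' j0 l : gamma (entering M x i) = q -> j0 < i ->
  (forall j, j < j0 -> delta q (tape M x i j) = (q, tape M x i j)) ->
  delta q (tape M x i j0) = (q', l) -> (forall l', delta q' l' = (q', l')) ->
  entering M x i.+1 = q' /\
  forall j, tape M x i.+1 j = if j == j0 then l else tape M x i j.
Proof.
move=> gq lt_j0i idle hit absorb; have scq := scan_idle idle.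
have scq' j : j0 < j -> scan (tape M x i) q j = q'.
  elim: j => [|j IHj] //=; rewrite ltnS leq_eqVlt => /orP[/eqP<-|/IHj->].
    by rewrite scq // hit.
  by rewrite absorb.
split=> [|j]; first by rewrite enteringS gq scq'.
rewrite tapeS gq; case: (ltngtP j j0) => [ltjj|ltjj|->].
- by rewrite (ltn_trans ltjj) // scq ?idle // ltnW // (ltn_trans ltjj).
- by rewrite scq' // absorb if_same.
- by rewrite lt_j0i scq ?hit // ltnW.
Qed.

Inductive instruction (Q : Type) : Type :=
| Incr of nat & Q
| Decr of nat & Q & Q
| Stop.
Arguments Stop {Q}.

Definition relabel (Q Q' : Type) (f : Q -> Q') (a : instruction Q) :=
  match a with
  | Incr r q => Incr r (f q)
  | Decr r q z => Decr r (f q) (f z)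
  | Stop => Stop
  end.

Record machine : Type := Machine {
  control : finType;
  instr : control -> instruction control;
  control0 : control;
  rejecting : pred control
}.

(** A letter is the set of marks in a cell.  The boolean tells whether the
    instruction has already been carried out in the current round. *)
Definition counter_delta k (A : machine) (s : bool * control A)
    (l : {set 'I_k.+1}) : (bool * control A) * {set 'I_k.+1} :=
  if s.1 then (s, l) else
  match instr s.2 with
  | Incr r q => if inord r \in l then (s, l) else ((true, q), inord r |: l)
  | Decr r q z => if inord r \in l then ((true, q), l :\ inord r) else (s, l)
  | Stop => (s, l)
  end.

(** A decrement that found no mark has proved the counter to be 0.  An increment
    that found no free cell is tried again in the next round, where one more
    cell is available. *)
Definition counter_gamma (A : machine) (s : bool * control A) :
    bool * control A :=
  if s.1 then (false, s.2) else
  if instr s.2 is Decr _ _ z then (false, z) else s.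

Definition counter_transducer k (A : machine) : transducer :=
  @Transducer (bool * control A)%type {set 'I_k.+1}
    (@counter_delta k A) (@counter_gamma A) (true, control0 A)
    set0 [set inord 0] (fun s => rejecting s.2).

(** At the start of round [i], control is at [q] and counter [r] holds [m r].
    The last clause says that no mark is out of reach of round [i]; without it a
    decrement might mistake a nonzero counter for 0. *)
Definition represents k A x i (q : control A) (m : nat -> nat) : Prop :=
  let M := counter_transducer k A in
  [/\ gamma (entering M x i) = (false, q),
      forall r, r <= k -> \sum_(j < i) (inord r \in tape M x i j) = m r
    & forall j, i <= j -> tape M x i j = set0].

Lemma counter_done k A q (l : letter (counter_transducer k A)) :
  delta (t := counter_transducer k A) (true, q) l = ((true, q), l).
Proof. by []. Qed.

Lemma sum_change k (w w' : nat -> {set 'I_k.+1}) i j0 (r : 'I_k.+1) :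
  j0 < i -> (forall j, j != j0 -> w' j = w j) ->
  \sum_(j < i) (r \in w' j) + (r \in w j0) =
  \sum_(j < i) (r \in w j) + (r \in w' j0).
Proof.
move=> lt_j0i ww'; rewrite (bigD1 (Ordinal lt_j0i)) //=.
rewrite [in RHS](bigD1 (Ordinal lt_j0i)) //=.
rewrite (eq_bigr (fun j : 'I_i => r \in w j : nat)) => [|j jj0].
  by rewrite addnAC [RHS]addnAC (addnC (r \in w' j0)).
by rewrite ww'.
Qed.

Lemma inord_eq k r r' : r <= k -> r' <= k ->
  (inord r == inord r' :> 'I_k.+1) = (r == r').
Proof. by move=> rk rk'; rewrite -val_eqE /= !inordK. Qed.

(** A round that changes a single letter, and there only the mark [r], changes
    only the counter [r]. *)
Lemma represents_hit k A x i q q' m r y j0 (l : {set 'I_k.+1}) :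
  let M := counter_transducer k A in
  r <= k -> @represents k A x i q m -> j0 < i ->
  (forall j, j < j0 ->
     @delta M (false, q) (tape M x i j) = ((false, q), tape M x i j)) ->
  @delta M (false, q) (tape M x i j0) = ((true, q'), l) ->
  (forall s, s != inord r -> (s \in l) = (s \in tape M x i j0)) ->
  m r + (inord r \in l) = y + (inord r \in tape M x i j0) ->
  represents k x i.+1 q' (update m r y).
Proof.
move=> M rk [gq sums empty] lt_j0 idle hit other yE.
have [enter tp] := @column_hit M x i _ _ _ _ gq lt_j0 idle hit (@counter_done k A q').
split=> [|s sk|j1 le_j1]; first by rewrite enter.
  rewrite big_ord_recr /= tp gtn_eqF // empty // inE addn0.
  have := @sum_change k (tape M x i) (tape M x i.+1) i j0 (inord s) lt_j0 _.
  rewrite sums // tp eqxx /update => /(_ _)-H.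
  have {}H := H (fun j1 (j1E : j1 != j0) => etrans (tp j1) (ifN _ _ j1E)).
  case: eqP H => [->|/eqP sr]; last first.
    by rewrite other ?inord_eq // => /addIn.
  by rewrite yE => /addIn.
rewrite tp gtn_eqF; last exact: leq_trans (ltnW le_j1).
by apply: empty; rewrite ltnW.
Qed.

Lemma first_of (P : pred nat) i : (exists2 j, j < i & P j) ->
  exists j0, [/\ j0 < i, P j0 & forall j, j < j0 -> ~~ P j].
Proof.
case=> j lt_ji Pj; case: (ex_minnP (ex_intro P j Pj)) => j0 Pj0 min0.
exists j0; split=> //; first exact: leq_ltn_trans (min0 _ Pj) lt_ji.
by move=> j1; rewrite ltnNge; apply: contra; apply: min0.
Qed.

Lemma represents_Incr k A x i q m r q' : r <= k ->
  instr q = Incr r q' -> @represents k A x i q m ->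
  exists i', represents k x i' q' (update m r (m r).+1).
Proof.
move=> rk qE rep; set M := counter_transducer k A.
have hit i0 : represents k x i0 q m ->
    (exists2 j, j < i0 & inord r \notin tape M x i0 j) ->
    represents k x i0.+1 q' (update m r (m r).+1).
  move=> rep0 /first_of[j0 [lt_j0 rj0 min0]].
  apply: (represents_hit (l := inord r |: tape M x i0 j0)) rep0 lt_j0 _ _ _ _.
  - by [].
  - move=> j1 /min0; rewrite negbK => rj1.
    by rewrite /= /counter_delta /= qE rj1.
  - by rewrite /= /counter_delta /= qE (negPf rj0).
  - by move=> s sr; rewrite !inE (negPf sr).
  - by rewrite !inE eqxx (negPf rj0) addn0 addn1.
case: (boolP [exists j : 'I_i, inord r \notin tape M x i j]).
  by move=> /existsP[j rj]; exists i.+1; apply: hit => //; exists j.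
rewrite negb_exists => /forallP full; have [gq sums empty] := rep.
have [enter tp] : entering M x i.+1 = (false, q) /\ tape M x i.+1 =1 tape M x i.
  apply: column_idle gq _ => j lt_ji.
  have := full (Ordinal lt_ji); rewrite negbK /= => rj.
  by rewrite /counter_delta /= qE rj.
exists i.+2; apply: hit; last first.
  by exists i; rewrite // tp empty // inE.
split=> [|s sk|j lt_ij]; first by rewrite enter /= /counter_gamma /= qE.
  rewrite big_ord_recr /= tp empty // inE addn0 -sums //.
  by apply: eq_bigr => j _; rewrite tp.
by rewrite tp empty // ltnW.
Qed.

Lemma represents_Decr k A x i q m r q' z : r <= k ->
  instr q = Decr r q' z -> @represents k A x i q m ->
  exists i', represents k x i' (if m r == 0 then z else q') (update m r (m r).-1).
Proof.
move=> rk qE rep; set M := counter_transducer k A; have [gq sums empty] := rep.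
exists i.+1; have := sums r rk; have [m0|mn0 sr] := eqVneq (m r) 0.
  rewrite m0 => /eqP; rewrite sum_nat_eq0 => /forallP none.
  have [enter tp] : entering M x i.+1 = (false, q) /\ tape M x i.+1 =1 tape M x i.
    apply: column_idle gq _ => j lt_ji; have := none (Ordinal lt_ji).
    by rewrite /= eqb0 => /negPf rj; rewrite /counter_delta /= qE rj.
  split=> [|s sk|j lt_ij]; first by rewrite enter /= /counter_gamma /= qE.
    rewrite big_ord_recr /= tp empty // inE addn0 /update.
    rewrite (_ : (if s == r then _ else _) = m s); last by case: eqP => [->|].
    by rewrite -sums //; apply: eq_bigr => j _; rewrite tp.
  by rewrite tp empty // ltnW.
have /first_of[j0 [lt_j0 rj0 min0]] : exists2 j, j < i & inord r \in tape M x i j.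
  case: (boolP [exists j : 'I_i, inord r \in tape M x i j]) => [/existsP[j rj]|].
    by exists j.
  rewrite negb_exists => /forallP none; case/eqP: mn0; rewrite -sr.
  by apply: big1 => j _; rewrite (negPf (none j)).
apply: (represents_hit (l := tape M x i j0 :\ inord r)) rep lt_j0 _ _ _ _.
- by [].
- by move=> j1 /min0 rj1; rewrite /= /counter_delta /= qE (negPf rj1).
- by rewrite /= /counter_delta /= qE rj0.
- by move=> s sr'; rewrite !inE sr'.
- by rewrite !inE eqxx rj0 addn0 addn1 prednK // lt0n.
Qed.

Lemma represents_ext k A x i q m m' : m =1 m' ->
  @represents k A x i q m -> represents k x i q m'.
Proof. by move=> mm' [? sums ?]; split=> // r rk; rewrite sums. Qed.

(** A loop is represented by its test, [None], and the control points of its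
    body; a sequence needs no point of its own. *)
Fixpoint control_points (c : program) : finType :=
  match c with
  | Inc _ | Dec _ => unit
  | Seq c1 c2 => (control_points c1 + control_points c2)%type
  | Loop _ c1 => option (control_points c1)
  end.

Fixpoint entry (c : program) : control_points c :=
  match c with
  | Inc _ | Dec _ => tt
  | Seq c1 _ => inl (entry c1)
  | Loop _ _ => None
  end.

(** [None] as a target stands for the exit of the program. *)
Fixpoint code (c : program) : control_points c -> instruction (option (control_points c)) :=
  match c with
  | Inc r => fun _ => Incr r None
  | Dec r => fun _ => Decr r None None
  | Seq c1 c2 => fun p =>
      match p with
      | inl p1 => relabel (fun o => Some (if o is Some p' then inl p'
                                          else inr (entry c2))) (code p1)
      | inr p2 => relabel (omap inr) (code p2)
      end
  | Loop r c1 => fun p =>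
      if p is Some p1 then relabel Some (code p1)
      else Decr r (Some (Some (entry c1))) None
  end.

Fixpoint max_register (c : program) : nat :=
  match c with
  | Inc r | Dec r => r
  | Seq c1 c2 => maxn (max_register c1) (max_register c2)
  | Loop r c1 => maxn r (max_register c1)
  end.

Lemma relabel_comp (Q Q' Q'' : Type) (f : Q -> Q') (f' : Q' -> Q'') a :
  relabel f' (relabel f a) = relabel (f' \o f) a.
Proof. by case: a. Qed.

Lemma eq_relabel (Q Q' : Type) (f f' : Q -> Q') a :
  f =1 f' -> relabel f a = relabel f' a.
Proof. by move=> ff'; case: a => [r q|r q z|] /=; rewrite ?ff'. Qed.

(** A program may sit anywhere inside a machine: [emb] places its control points
    and [exit] says where it leaves to, which is what the induction needs for
    the parts of a sequence and the body of a loop. *)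
Lemma exec_represents k A c m m' :
  exec c m m' -> max_register c <= k ->
  forall (emb : control_points c -> control A) (exit : control A),
    (forall p, instr (emb p) = relabel (fun o => if o is Some p' then emb p' else exit) (code p)) ->
  forall x i, represents k x i (emb (entry c)) m ->
  exists i', represents k x i' exit m'.
Proof.
elim=> {c m m'} [r m|r m|c1 c2 m1 m2 m3 _ IH1 _ IH2|r c m m0|r c m1 m2 m3 mn0 _ IH1 _ IH2].
- by move=> rk emb exit embE x i /represents_Incr; apply=> //; rewrite embE.
- move=> rk emb exit embE x i /represents_Decr-/(_ r exit exit rk).
  by rewrite if_same; apply; rewrite embE.
- rewrite /= geq_max => /andP[le1 le2] emb exit embE x i rep.
  have [||i1 rep1] := IH1 le1 (emb \o inl) (emb (inr (entry c2))) _ x i.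
  - move=> p; rewrite /= embE /= relabel_comp; apply: eq_relabel.
    by case.
  - exact: rep.
  apply: (IH2 le2 (emb \o inr) exit _ x i1) rep1 => p; rewrite /= embE /= relabel_comp.
  by apply: eq_relabel; case.
- rewrite /= geq_max => /andP[rk _] emb exit embE x i rep.
  have [i1 rep1] := represents_Decr rk (embE None) rep.
  exists i1; rewrite m0 eqxx in rep1; apply: represents_ext rep1 => s.
  by rewrite /update; case: eqP => [->|].
- move=> le_k emb exit embE x i rep.
  have := le_k; rewrite /= geq_max => /andP[rk le1].
  have [i1] := represents_Decr rk (embE None) rep.
  move/eqP/negPf: mn0 => -> rep1.
  have [||i2 rep2] := IH1 le1 (emb \o Some) (emb None) _ x i1.
  - by move=> p; rewrite /= embE /= relabel_comp; apply: eq_relabel; case.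
  - exact: rep1.
  exact: IH2 rep2.
Qed.

(** In the rounds up to [x] the visible cells are all marked, so an initial
    increment of counter 0 has to wait until round [x], by which time the whole
    input is within reach. *)
Lemma represents_initial k A x q : instr (control0 A) = Incr 0 q ->
  @represents k A x x (control0 A) (fun r => if r == 0 then x else 0).
Proof.
move=> iE; set M := counter_transducer k A.
have idle i : i <= x ->
    gamma (entering M x i) = (false, control0 A) /\ tape M x i =1 initial M x.
  elim: i => [|i IHi] lt_ix; first by [].
  have [gq tp] := IHi (ltnW lt_ix).
  have [enter tpS] : entering M x i.+1 = (false, control0 A) /\
      tape M x i.+1 =1 tape M x i.
    apply: column_idle gq _ => j lt_ji.
    rewrite tp /initial (ltn_trans lt_ji) // /= /counter_delta /= iE.
    by rewrite inE eqxx.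
  by split=> [|j]; rewrite ?enter /= ?/counter_gamma /= ?iE // tpS tp.
have [gq tp] := idle x (leqnn x).
split=> [|r rk|j le_xj]; first exact: gq.
  have tpE (j : 'I_x) : tape M x x j = [set inord 0] by rewrite tp /initial ltn_ord.
  rewrite (eq_bigr (fun _ => (r == 0) : nat)) => [|j _].
    by rewrite sum_nat_const card_ord; case: eqP; rewrite ?muln0 ?muln1.
  by rewrite tpE inE inord_eq.
by rewrite tp /initial ltnNge le_xj.
Qed.

(** After the program, the machine goes to rest in a rejecting or in a harmless
    state according to whether the result is 0. *)
Definition decision_machine (c : program) (o : nat) : machine :=
  @Machine (control_points c + option bool)%type
    (fun q => match q with
     | inl p => relabel (fun x => if x is Some p' then inl p' else inr None)
                  (code p)
     | inr None => Decr o (inr (Some true)) (inr (Some false))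
     | inr (Some _) => Stop
     end)
    (inl (entry c))
    (pred1 (inr (Some true))).

Lemma Stop_absorbing k A x i j (q : control A) : instr q = Stop ->
  (entering (counter_transducer k A) x i).2 = q -> i <= j ->
  (entering (counter_transducer k A) x j).2 = q.
Proof.
set M := counter_transducer k A; move=> qE eq_i /subnK <-.
elim: (j - i) => [|d]; rewrite ?add0n // addSn; move: (d + i) => {eq_i}n nq.
have gq : gamma (entering M x n) = (false, q).
  case: (entering M x n) nq => b p /= ->; rewrite /counter_gamma /=.
  by case: b; rewrite ?qE.
have [|-> //] := column_idle gq.
by move=> j' _; rewrite /= /counter_delta /= qE.
Qed.

(** The program begins with an increment, which waits for the input to be within
    reach (represents_initial); the input being [x + 1], two decrements restore
    [x]. *)
Theorem transducer_decides (d : 1.-tuple nat -> nat) : recursive d ->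
  exists M, forall x,
    (forall i, ~~ bad (entering M x.+1 i)) <-> d [tuple x] = 0.
Proof.
move=> rd; have [|||c Hc] := recursive_computable rd (a := [tuple 0]) (o := 1) (b := 2).
- by move=> r; rewrite inE => /eqP->.
- by [].
- by [].
pose p := Seq (Inc 0) (Seq (Seq (Dec 0) (Dec 0)) c).
pose k := maxn 1 (max_register p); pose A := decision_machine p 1.
exists (counter_transducer k A) => x; set M := counter_transducer k A.
have [m [em mx]] : exists m, exec p (fun r => if r == 0 then x.+1 else 0) m /\
    m 1 = d [tuple x].
  pose m1 := update (fun r => if r == 0 then x.+1 else 0) 0 x.+2.
  pose m2 := update m1 0 x.+1; pose m3 := update m2 0 x.
  have [m' [em' m'1 _]] := Hc m3; exists m'; split.
    by apply: exec_Seq (exec_Seq (exec_Seq _ _) em'); constructor.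
  by rewrite m'1; congr d; apply: val_inj.
have rep0 := @represents_initial k A x.+1 _ erefl.
have [i rep] := @exec_represents k A _ _ _ em (leq_maxr 1 _) inl (inr None)
  (fun _ => erefl) _ _ rep0.
have [i' rep'] := @represents_Decr k A _ _ (inr None) _ 1 (inr (Some true))
  (inr (Some false)) (leq_maxl 1 _) erefl rep.
have {rep'} final b : (m 1 != 0) = b ->
    entering M x.+1 i'.+1 = (false, inr (Some b)).
  move=> bE; have [gq _ _] := rep'.
  have qE : (if m 1 == 0 then inr (Some false) else inr (Some true)) =
      inr (Some b) :> control A by rewrite -bE; case: eqP.
  by rewrite qE in gq; have [|-> //] := column_idle gq.
rewrite -mx; split=> [good|m0 j].
  apply/eqP; apply: contraNT (good i'.+1) => /final ->.
  exact: eqxx.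
have fin := final false; rewrite m0 in fin; have {}fin := fin erefl.
apply/negP => /eqP jbad.
have [le_ij|/ltnW le_ji] := leqP i'.+1 j.
  by have := @Stop_absorbing k A _ _ _ (inr (Some false)) erefl (congr1 snd fin) le_ij;
  rewrite jbad.
by have := @Stop_absorbing k A _ _ _ (inr (Some true)) erefl jbad le_ji; rewrite fin.
Qed.

(** * Columns and levels of the positive vertices *)

Definition level n := logn 2 n.
Definition column n := trunc_log 2 n.
(** The positive tail of the u-edge that enters [n], if [n] is not a power of
    2. *)
Definition upred n := n - 2 ^ (level n).+1.

Arguments level : simpl never.
Arguments column : simpl never.
Arguments upred : simpl never.

Lemma level_odd v o : odd o -> level (2 ^ v * o) = v.
Proof.
move=> oo; have o_gt0 : 0 < o by case: o oo.
rewrite /level lognM ?expn_gt0 // pfactorK // logn_coprime ?addn0 //.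
by rewrite coprime2n.
Qed.

Lemma level_pow v : level (2 ^ v) = v.
Proof. exact: pfactorK. Qed.

Lemma levelP n : 0 < n -> exists2 o, odd o & n = 2 ^ level n * o.
Proof.
move=> n_gt0; have [|o co nE] := @pfactor_coprime 2 n _ n_gt0; first by [].
by exists o; rewrite -?coprime2n // mulnC.
Qed.

Lemma column_eq i n : 2 ^ i <= n < 2 ^ i.+1 -> column n = i.
Proof. exact: trunc_log_eq. Qed.

Lemma column_pow i : column (2 ^ i) = i.
Proof. exact: trunc_expnK. Qed.

Lemma columnP n : 0 < n -> exists2 r, r < 2 ^ column n & n = 2 ^ column n + r.
Proof.
move=> n_gt0; have /andP[le_n lt_n] : 2 ^ column n <= n < 2 ^ (column n).+1.
  exact: trunc_log_bounds.
by exists (n - 2 ^ column n); rewrite ?subnKC // ltn_subLR // addnn -mul2n -expnS.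
Qed.

Lemma column_mul v o : 0 < o -> column (2 ^ v * o) = v + column o.
Proof.
move=> o_gt0; apply: column_eq.
have /andP[le_o lt_o] : 2 ^ column o <= o < 2 ^ (column o).+1.
  exact: trunc_log_bounds.
by rewrite -addnS !expnD leq_pmul2l ?ltn_pmul2l ?expn_gt0 // le_o.
Qed.

Lemma pow_eq n : (n == 2 ^ level n) = (n == 2 ^ column n).
Proof.
apply/eqP/eqP => nE; first by rewrite {2}nE column_pow -nE.
by rewrite {2}nE level_pow -nE.
Qed.

(** Write r = 2^v o with o odd; the u-predecessor of 2^i + r is at distance
    2^(v+1).  If o = 1 this leads to 2^i - 2^v, which is in column i - 1 because
    v < i; if o >= 3 it stays in column i. *)
Lemma column_upred i r : 0 < r < 2 ^ i ->
  level (2 ^ i + r) = level r /\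
  if r == 2 ^ level r then (column (upred (2 ^ i + r))).+1 = i
  else column (upred (2 ^ i + r)) = i.
Proof.
case/andP=> r_gt0 lt_r; have [o oo rE] := levelP r_gt0.
move: (level r) rE => v rE; have o_gt0 : 0 < o by case: o oo {rE}.
have [e iE] : exists e, i = v + e.+1.
  have lt_vi : v < i.
    rewrite -(ltn_exp2l v i (isT : 1 < 2)); apply: leq_ltn_trans lt_r.
    by rewrite rE leq_pmulr.
  by exists (i - v.+1); rewrite -addSnnS subnKC.
have nE : 2 ^ i + r = 2 ^ v * (2 ^ e.+1 + o) by rewrite iE rE expnD mulnDr.
have no : odd (2 ^ e.+1 + o) by rewrite oddD oddX oo.
rewrite /upred nE level_odd //; split=> //.
have -> : 2 ^ v * (2 ^ e.+1 + o) - 2 ^ v.+1 = 2 ^ v * (2 ^ e.+1 + o - 2).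
  by rewrite mulnBr [2 ^ v.+1]expnSr.
have lt_o : o < 2 ^ e.+1.
  by rewrite -(ltn_pmul2l (expn_gt0 2 v : 0 < 2 ^ v)) -rE -expnD -iE.
have e_gt0 : 2 <= 2 ^ e.+1 by rewrite expnS leq_pmulr ?expn_gt0.
rewrite rE -{2}[2 ^ v]muln1 eqn_pmul2l ?expn_gt0 // column_mul; last by lia.
have eS : 2 ^ e.+1 = 2 * 2 ^ e by rewrite expnS.
have e0 : 0 < 2 ^ e by rewrite expn_gt0.
rewrite iE; case: eqP => [o1|on1].
  by rewrite addnS (@column_eq e) //; rewrite eS o1; lia.
rewrite (@column_eq e.+1) // [2 ^ e.+2]expnS.
have : o != 2 by apply: contraTneq oo => ->.
by move: lt_o on1; rewrite eS; lia.
Qed.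

(** How a vertex of kind [k] acts on what it receives: [None] is a power of 2,
    [Some true] a cell, [Some false] a vertex that lets both pass. *)
Definition state_out M (k : option bool) (q : state M) (a : letter M) : state M :=
  match k with
  | None => gamma q
  | Some true => (delta q a).1
  | Some false => q
  end.

Definition letter_out M (k : option bool) (q : state M) (a : letter M) : letter M :=
  if k == Some true then (delta q a).2 else a.

Definition kind_at n : option bool :=
  if n == 2 ^ level n then None
  else Some (odd (column (upred n)) != odd (column n)).

(** The state that enters vertex [n] in the intended colouring: past the power
    2^i, the cells 2^i + 2^j of the column that precede n = 2^i + r are those
    with 2^j < r, and their number is the rounded up logarithm of r. *)
Definition state_at M x n : state M :=
  let i := column n in
  if n == 2 ^ level n then entering M x i
  else scan (tape M x i) (gamma (entering M x i)) (up_log 2 (n - 2 ^ i)).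

(** A letter leaves column i as the tape has it after round i, and that is how
    it enters the next vertex of its level. *)
Definition letter_at M x n : letter M :=
  if n == 2 ^ level n then initial M x (level n)
  else tape M x (column (upred n)).+1 (level n).

Arguments kind_at : simpl never.
Arguments state_at : simpl never.
Arguments letter_at : simpl never.

Lemma not_pow i r : 0 < r < 2 ^ i ->
  column (2 ^ i + r) = i /\ (2 ^ i + r == 2 ^ level (2 ^ i + r)) = false.
Proof.
move=> /andP[r_gt0 lt_r]; have cE : column (2 ^ i + r) = i.
  by apply: column_eq; rewrite expnS; lia.
by rewrite pow_eq cE; split=> //; apply/eqP; lia.
Qed.

Lemma state_at_column M x i r : 0 < r <= 2 ^ i ->
  state_at M x (2 ^ i + r) =
  scan (tape M x i) (gamma (entering M x i)) (up_log 2 r).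
Proof.
case/andP=> r_gt0; rewrite leq_eqVlt => /orP[/eqP->|lt_r].
  rewrite addnn -mul2n -expnS /state_at level_pow eqxx column_pow enteringS.
  by rewrite up_expnK.
have rr : 0 < r < 2 ^ i by rewrite r_gt0.
have [cE pE] := not_pow rr; rewrite /state_at pE cE.
by rewrite addKn.
Qed.

(** At 2^i + r with r = 2^j the automaton passes from cell j to cell j + 1, which
    is the rounded up logarithm of r + 1; if r is not a power of 2, then r and
    r + 1 have the same rounded up logarithm, and the state does not change. *)
Lemma state_out_at M x n : 0 < n ->
  state_out (kind_at n) (state_at M x n) (letter_at M x n) = state_at M x n.+1.
Proof.
move=> n_gt0; have [r lt_r nE] := columnP n_gt0.
move: (column n) lt_r nE => i lt_r nE; rewrite {n_gt0 n}nE -addnS.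
rewrite [RHS]state_at_column //; have [->|r_neq0] := posnP r.
  by rewrite addn0 /kind_at /state_at level_pow eqxx column_pow.
have rr : 0 < r < 2 ^ i by rewrite r_neq0.
have rle : 0 < r <= 2 ^ i by rewrite r_neq0 ltnW.
have [cE pE] := not_pow rr; have [lE] := column_upred rr.
rewrite state_at_column // /kind_at pE cE /letter_at pE lE.
case: eqP => [rE|rE] uE.
  have -> : (odd (column (upred (2 ^ i + r))) != odd i) = true.
    by move: (column _) uE => c <- /=; case: odd.
  have le2 : 0 < 2 ^ level r by rewrite expn_gt0.
  rewrite uE [in RHS]rE {1}rE up_expnK // (@up_log_eq 2 (level r)) //.
  by rewrite expnS; lia.
rewrite uE eqxx /=; congr scan.
have r_gt1 : 1 < r.
  by case: r r_neq0 rE {lt_r rr rle cE pE lE uE} => [|[|r]] //; rewrite level_odd.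
have /andP[lo hi] := up_log_bounds (isT : 1 < 2) r_gt1.
have hi' : r < 2 ^ up_log 2 r.
  rewrite ltn_neqAle hi andbT; apply/eqP => rE'; apply: rE.
  by rewrite {2}rE' level_pow.
have u_gt0 : 0 < up_log 2 r by rewrite up_log_gt0.
apply/esym; case: (up_log 2 r) lo hi' u_gt0 => // u lo hi' _.
by apply: up_log_eq; rewrite // hi' andbT ltnS ltnW.
Qed.

Lemma letter_out_at M x n : 0 < n ->
  letter_out (kind_at n) (state_at M x n) (letter_at M x n) =
  tape M x (column n).+1 (level n).
Proof.
move=> n_gt0; have [r lt_r nE] := columnP n_gt0.
move: (column n) lt_r nE => i lt_r nE; rewrite {n_gt0 n}nE.
have [->|r_gt0] := posnP r.
  by rewrite addn0 /kind_at /letter_at level_pow eqxx /letter_out tape_initial.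
have rr : 0 < r < 2 ^ i by rewrite r_gt0.
have rle : 0 < r <= 2 ^ i by rewrite r_gt0 ltnW.
have [cE pE] := not_pow rr; have [lE] := column_upred rr.
rewrite state_at_column // /kind_at pE cE /letter_at pE lE /letter_out.
case: eqP => [rE|rE] uE; last by rewrite uE eqxx.
have -> : (odd (column (upred (2 ^ i + r))) != odd i) = true.
  by move: (column _) uE => c <- /=; case: odd.
rewrite uE tapeS /= {1 2}rE up_expnK // -(ltn_exp2l _ _ (isT : 1 < 2)) -rE.
by rewrite lt_r.
Qed.

Lemma parity_at n : 0 < n ->
  odd (column n.+1) = (n.+1 == 2 ^ level n.+1) (+) odd (column n).
Proof.
move=> n_gt0; have [r lt_r nE] := columnP n_gt0.
move: (column n) lt_r nE => i lt_r nE; rewrite {n_gt0 n}nE -addnS.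
have := lt_r; rewrite leq_eqVlt => /orP[/eqP->|lt_r1].
  by rewrite addnn -mul2n -expnS level_pow eqxx column_pow.
by have [|-> ->] := @not_pow i r.+1; first by rewrite ltnS.
Qed.

Lemma upred_mul s m : 0 < m ->
  [/\ level (2 ^ s * (2 * m + 1)) = s,
      (2 ^ s * (2 * m + 1) == 2 ^ s) = false
    & upred (2 ^ s * (2 * m + 1)) = 2 ^ s * (2 * m - 1)].
Proof.
move=> m_gt0; have lE : level (2 ^ s * (2 * m + 1)) = s.
  by rewrite level_odd // addn1 mul2n /= odd_double.
split=> //; first by rewrite -{2}[2 ^ s]muln1 eqn_pmul2l ?expn_gt0 //; lia.
rewrite /upred lE expnSr -mulnBr; congr (_ * _); lia.
Qed.

(** * Domino instances and their codes *)

Section IntEdges.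
Import GRing.Theory Num.Theory.
Local Open Scope ring_scope.

(** Colourings of the graph split into the part [f] on the nonnegative and the
    part [g] on the nonpositive vertices, which removes integers from the rest
    of the proof.  The three families of u-edges are those inside each part and
    the edges from -2^s to 2^s. *)
Lemma long_range_colouring (R : nat -> tu -> nat -> Prop) :
  (exists tau : int -> nat, forall e : long_range_edge,
     R (tau (long_range_tail e)) (long_range_label e) (tau (long_range_head e)))
  <->
  exists f g : nat -> nat,
    [/\ g 0%N = f 0%N, R (f 0%N) label_u (f 0%N),
      forall n, R (f n) label_t (f n.+1) /\ R (g n.+1) label_t (g n),
      forall s, R (g (2 ^ s)%N) label_u (f (2 ^ s)%N)
    & forall s m, (0 < m)%N ->
        R (f (2 ^ s * (2 * m - 1))%N) label_u (f (2 ^ s * (2 * m + 1))%N) /\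
        R (g (2 ^ s * (2 * m + 1))%N) label_u (g (2 ^ s * (2 * m - 1))%N)].
Proof.
have posE s m : (0 < m)%N ->
    2 ^+ s * (2 * m%:Z - 1) = (2 ^ s * (2 * m - 1))%N%:Z :> int /\
    2 ^+ s * (2 * m%:Z + 1) = (2 ^ s * (2 * m + 1))%N%:Z :> int.
  move=> m_gt0; have -> : 2 ^+ s = (2 ^ s)%N%:Z by rewrite -natrX natz.
  split; rewrite PoszM; congr (_ * _); lia.
have negE s m : (0 < m)%N ->
    2 ^+ s * (2 * (- m%:Z) - 1) = - (2 ^ s * (2 * m + 1))%N%:Z :> int /\
    2 ^+ s * (2 * (- m%:Z) + 1) = - (2 ^ s * (2 * m - 1))%N%:Z :> int.
  move=> m_gt0; have [<- <-] := posE s m m_gt0; split; ring.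
have midE s : 2 ^+ s * (2 * 0 - 1) = - (2 ^ s)%N%:Z :> int /\
    2 ^+ s * (2 * 0 + 1) = (2 ^ s)%N%:Z :> int.
  have -> : 2 ^+ s = (2 ^ s)%N%:Z by rewrite -natrX natz.
  by split; ring.
split=> [[tau H]|[f [g [g0 loop Ht Hc Hu]]]].
  exists (fun n => tau n%:Z), (fun n => tau (- n%:Z)); split.
  - by rewrite oppr0.
  - exact: H loop_u.
  - move=> n; split.
      have := H (edge_t n%:Z) => /=; rewrite (_ : n%:Z + 1 = n.+1%:Z) //; lia.
    have := H (edge_t (- n.+1%:Z)) => /=.
    by rewrite (_ : - n.+1%:Z + 1 = - n%:Z) //; lia.
  - by move=> s; have := H (edge_u 0 s) => /=; case: (midE s) => -> ->.
  - move=> s m m_gt0; split.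
      by have := H (edge_u m%:Z s) => /=; case: (posE s m m_gt0) => -> ->.
    by have := H (edge_u (- m%:Z) s) => /=; case: (negE s m m_gt0) => -> ->.
pose tau (n : int) := match n with Posz k => f k | Negz k => g k.+1 end.
have tauN k : tau (- k%:Z) = g k by case: k => [|k] //; rewrite oppr0 g0.
exists tau => -[n||m s] /=; last 1 first.
- case: m => [[|m]|m].
  + by case: (midE s) => -> ->; rewrite tauN; apply: Hc.
  + by case: (posE s m.+1 isT) => -> ->; case: (Hu s m.+1 isT).
  + rewrite NegzE; case: (negE s m.+1 isT) => -> ->; rewrite !tauN.
    by case: (Hu s m.+1 isT).
- case: n => [n|n]; first by rewrite (_ : n%:Z + 1 = n.+1%:Z); [case: (Ht n)|lia].
  by rewrite NegzE (_ : - n.+1%:Z + 1 = - n%:Z) ?tauN; [case: (Ht n)|lia].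
- exact: loop.
Qed.
End IntEdges.

Definition triple_word (L : seq (nat * tu * nat)) : seq nat :=
  flatten [seq [:: p.1.1; val (enum_rank p.1.2); p.2] | p <- L].

Definition instance K (L : seq (nat * tu * nat)) : domino_instance tu :=
  @DominoInstance tu K.+1 [seq (inord p.1.1, p.1.2, inord p.2) | p <- L].

Definition colours_le K (L : seq (nat * tu * nat)) :=
  forall p, p \in L -> p.1.1 <= K /\ p.2 <= K.

Lemma instance_code K L : colours_le K L ->
  domino_code (instance K L) = CodeSeq.code (K.+1 :: triple_word L).
Proof.
move=> LK; rewrite /domino_code /= -map_comp; congr (CodeSeq.code (_ :: flatten _)).
by apply/eq_in_map => p /LK[p1 p2] /=; rewrite !inordK.
Qed.

Lemma instance_tileable K L : colours_le K L ->
  tileable long_range_graph [set p in triples (instance K L)] <->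
  exists tau : int -> nat, forall e : long_range_edge,
    (tau (long_range_tail e), long_range_label e, tau (long_range_head e)) \in L.
Proof.
move=> LK; split=> [[tau H]|[tau H]].
  exists (fun n => val (tau n)) => e; have := H e; rewrite inE.
  case/mapP=> -[[a l] b] abL [-> -> ->] /=; have [/= aK bK] := LK _ abL.
  by rewrite !inordK.
exists (fun n => inord (tau n)) => e; rewrite inE.
by apply/mapP; exists (tau (long_range_tail e), long_range_label e, tau (long_range_head e)).
Qed.

(** The triples for the input [x].  Colour numbers below B = 4 x belong to the
    program; vertex -k has the colour B + k for k <= 2^x.  Among the numbers of
    the program, 4 c + 1 is the colour of a negative vertex, 4 c + 2 is possible
    at vertex 1, and 4 c + 2 and 4 c + 3 are possible at a power of 2 that
    receives a non-blank letter.  Nothing tells which c < x are really in use;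
    for the others the superfluous triples are harmless, since the program has no
    triple that continues them.

    Along u, B + k may be followed by all B + k' with k' < k and not just by the
    colour of the neighbour: this already excludes loops, and is easier to
    enumerate.
    Abstracting over [add] gives the list of triples and the arithmetic
    operation on codes at once. *)
Definition chain_triples (T : Type) (add : nat -> tu -> nat -> T -> T) (x : nat)
    (s : T) : T :=
  let B := 4 * x in let N := 2 ^ x in
  add B label_u B
  (iteri x (fun c s => add (4 * c + 1) label_t (B + N) (add B label_t (4 * c + 2) s))
  (iteri N (fun k s => add (B + k).+1 label_t (B + k) s)
  (iteri N.+1 (fun k s =>
     iteri k (fun k' s => add (B + k) label_u (B + k') s)
     (iteri x (fun c s => add (4 * c + 1) label_u (B + k)
        (add (B + k) label_u (4 * c + 2) (add (B + k) label_u (4 * c + 3) s))) s)) s))).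

Lemma morph_iteri (T T' : Type) (phi : T -> T') n (G : nat -> T -> T)
    (G' : nat -> T' -> T') s s' :
  (forall i s, phi (G i s) = G' i (phi s)) -> phi s = s' ->
  phi (iteri n G s) = iteri n G' s'.
Proof. by move=> GG' <-; elim: n => //= n IHn; rewrite GG' IHn. Qed.

Lemma morph_chain_triples (T T' : Type) (phi : T -> T') add add' x s :
  (forall a l b s, phi (add a l b s) = add' a l b (phi s)) ->
  phi (chain_triples add x s) = chain_triples add' x (phi s).
Proof.
move=> addE; rewrite /chain_triples addE; congr add'.
apply: morph_iteri => [c {}s|]; first by rewrite !addE.
apply: morph_iteri => [k {}s|]; first by rewrite addE.
apply: morph_iteri => [k {}s|//].
apply: morph_iteri => [k' {}s|]; first by rewrite addE.
by apply: morph_iteri => [c {}s|//]; rewrite !addE.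
Qed.

(** The effect on codes of adding an entry in front of a word. *)
Definition code_cons (a y : nat) : nat := 2 ^ a * (2 * y + 1).

Definition code_add (a : nat) (l : tu) (b y : nat) : nat :=
  code_cons a (code_cons (val (enum_rank l)) (code_cons b y)).

Definition cons_triple a l b (L : seq (nat * tu * nat)) := (a, l, b) :: L.

(** The code of the whole instance as a function of the code [x] of the program
    only: [x] is at the same time the input and the word to be extended. *)
Definition chain_code x :=
  code_cons (4 * x + 2 ^ x).+1 (chain_triples code_add x x).

Lemma code_consE a s : CodeSeq.code (a :: s) = code_cons a (CodeSeq.code s).
Proof. by rewrite /code_cons /= addn1 mul2n. Qed.

Lemma chain_codeE L (x := CodeSeq.code (triple_word L)) :
  CodeSeq.code ((4 * x + 2 ^ x).+1 :: triple_word (chain_triples cons_triple x L)) =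
  chain_code x.
Proof.
rewrite code_consE /chain_code; congr code_cons.
apply: (@morph_chain_triples _ _ (fun L => CodeSeq.code (triple_word L))) => a l b s.
by rewrite /code_add -!code_consE.
Qed.

Inductive chain_rule (x : nat) : nat -> tu -> nat -> Prop :=
| chain_loop : chain_rule x (4 * x) label_u (4 * x)
| chain_enter c : c < x -> chain_rule x (4 * c + 1) label_t (4 * x + 2 ^ x)
| chain_start c : c < x -> chain_rule x (4 * x) label_t (4 * c + 2)
| chain_step k : k < 2 ^ x -> chain_rule x (4 * x + k).+1 label_t (4 * x + k)
| chain_jump k k' : k <= 2 ^ x -> k' < k ->
    chain_rule x (4 * x + k) label_u (4 * x + k')
| chain_in c k : c < x -> k <= 2 ^ x ->
    chain_rule x (4 * c + 1) label_u (4 * x + k)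
| chain_out c k i : c < x -> k <= 2 ^ x -> (i == 2) || (i == 3) ->
    chain_rule x (4 * x + k) label_u (4 * c + i).

Lemma mem_iteri (T : eqType) n (G : nat -> seq T -> seq T) s0 p (P : nat -> Prop) :
  (forall i s, p \in G i s <-> P i \/ p \in s) ->
  p \in iteri n G s0 <-> (exists2 i, i < n & P i) \/ p \in s0.
Proof.
move=> GP; elim: n => [|n IHn] /=.
  by split; [right | case=> // -[]].
rewrite GP IHn; split=> [[Pn|[[i lt_in Pi]|ps0]]|[[i]|ps0]].
- by left; exists n.
- by left; exists i; rewrite // ltnW.
- by right.
- rewrite ltnS leq_eqVlt => /orP[/eqP->|lt_in] Pi; first by left.
  by right; left; exists i.
- by right; right.
Qed.

Lemma mem_cons_triple a l b L a' l' b' :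
  (a, l, b) \in cons_triple a' l' b' L <->
  (a, l, b) = (a', l', b') \/ (a, l, b) \in L.
Proof.
rewrite inE; split=> [/orP[/eqP|]|[->|->]]; rewrite ?eqxx ?orbT //; by [left|right].
Qed.

Lemma mem_chain_triples x L a l b :
  (a, l, b) \in chain_triples cons_triple x L <->
  chain_rule x a l b \/ (a, l, b) \in L.
Proof.
pose Q k' := (a, l, b) = k'.
rewrite mem_cons_triple.
rewrite (@mem_iteri _ x _ _ _ (fun c =>
  Q (4 * c + 1, label_t, 4 * x + 2 ^ x) \/ Q (4 * x, label_t, 4 * c + 2))); last first.
  by move=> i s; rewrite !mem_cons_triple /Q; tauto.
rewrite (@mem_iteri _ (2 ^ x) _ _ _ (fun k => Q ((4 * x + k).+1, label_t, 4 * x + k)));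
  last by move=> i s; rewrite mem_cons_triple.
rewrite (@mem_iteri _ (2 ^ x).+1 _ _ _ (fun k =>
  (exists2 k', k' < k & Q (4 * x + k, label_u, 4 * x + k')) \/
  exists2 c, c < x & [\/ Q (4 * c + 1, label_u, 4 * x + k),
    Q (4 * x + k, label_u, 4 * c + 2) | Q (4 * x + k, label_u, 4 * c + 3)])); last first.
  move=> k s; rewrite (@mem_iteri _ k _ _ _ (fun k' => Q (4 * x + k, label_u, 4 * x + k')));
    last by move=> i s'; rewrite mem_cons_triple.
  rewrite (@mem_iteri _ x _ _ _ (fun c => [\/ Q (4 * c + 1, label_u, 4 * x + k),
    Q (4 * x + k, label_u, 4 * c + 2) | Q (4 * x + k, label_u, 4 * c + 3)])).
    by tauto.
  by move=> i s'; rewrite !mem_cons_triple /Q; split;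
    [case=> [?|[?|[?|?]]]; [left; constructor 1|left; constructor 2|left; constructor 3|right]
    |case=> [[]|]; tauto].
rewrite /Q; split.
- case=> [[-> -> ->]|]; first by left; constructor.
  case=> [[c cx [[-> -> ->]|[-> -> ->]]]|]; try by left; constructor.
  case=> [[k kN [-> -> ->]]|]; first by left; constructor.
  case=> [[k kN [[k' kk' [-> -> ->]]|[c cx [] [-> -> ->]]]]|]; last by right.
  + by left; apply: chain_jump.
  + by left; apply: chain_in.
  + by left; apply: chain_out.
  + by left; apply: chain_out.
case=> [|abL]; last by do 4!right.
case=> {a l b Q} [|c cx|c cx|k kN|k k' kN kk'|c k cx kN|c k i cx kN i23].
- by left.
- by right; left; exists c; [|left].
- by right; left; exists c; [|right].
- by do 2!right; left; exists k.
- by do 3!right; left; exists k; [|left; exists k'].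
- by do 3!right; left; exists k; [|right; exists c; [|constructor 1]].
- do 3!right; left; exists k; [by []|right; exists c; [by []|]].
  by case/orP: i23 => /eqP->; [constructor 2|constructor 3].
Qed.

Lemma chain_triples_le x L : colours_le x L ->
  colours_le (4 * x + 2 ^ x) (chain_triples cons_triple x L).
Proof.
move=> Lx [[a l] b] /mem_chain_triples[|abL]; last first.
  by have [/=] := Lx _ abL; lia.
by case=> {a l b} * /=; lia.
Qed.

Lemma recursive_code_cons k (F G : k.-tuple nat -> nat) :
  recursive F -> recursive G -> recursive (fun v => code_cons (F v) (G v)).
Proof.
move=> rF rG; apply: recursive_mul; first exact: recursive_exp2.
apply: recursive_add; last exact: recursive_const.
by apply: recursive_mul => //; apply: recursive_const.
Qed.

Lemma recursive_code_add k l (F G H : k.-tuple nat -> nat) :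
  recursive F -> recursive G -> recursive H ->
  recursive (fun v => code_add (F v) l (G v) (H v)).
Proof.
move=> rF rG rH; apply: recursive_code_cons => //.
by apply: recursive_code_cons; [apply: recursive_const | apply: recursive_code_cons].
Qed.

(** The loops are treated from the outside in; [recursive_behead] accounts for
    the variables that each of them adds. *)
Lemma recursive_chain_code :
  recursive (fun v : 1.-tuple nat => chain_code (thead v)).
Proof.
pose rh k := recursive_head k; pose rb := recursive_behead.
have r4 k (F : k.-tuple nat -> nat) : recursive F -> recursive (fun v => 4 * F v).
  by move=> rF; apply: recursive_mul => //; apply: recursive_const.
have rD k (F : k.-tuple nat -> nat) i : recursive F -> recursive (fun v => F v + i).
  by move=> rF; apply: recursive_add => //; apply: recursive_const.
have rBN := recursive_add (r4 _ _ (rh 0)) (recursive_exp2 (rh 0)).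
apply: recursive_code_cons; first exact: recursive_S.
apply: recursive_code_add; [exact: r4 | exact: r4 |].
apply: recursive_iteri; first exact: rh.
  apply: recursive_iteri; first exact: recursive_exp2.
    apply: recursive_iteri; first exact/recursive_S/recursive_exp2.
      exact: rh.
    have rk := rb _ _ (r4 _ _ (rb _ _ (rh 0))).
    have rBk : recursive (fun w : 3.-tuple nat =>
        4 * thead (behead_tuple (behead_tuple w)) + thead w).
      by apply: recursive_add rk (rh _).
    apply: recursive_iteri; first exact: rh.
      apply: recursive_iteri; first exact: rb _ _ (rb _ _ (rh _)).
        exact: rb _ _ (rh _).
      have rBk' := rb _ _ (rb _ _ rBk).
      apply: recursive_code_add => //; first exact/rD/r4.
      apply: recursive_code_add => //; first exact/rD/r4.
      apply: recursive_code_add => //; first exact/rD/r4.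
      exact: rb _ _ (rh _).
    have rBk' := rb _ _ (rb _ _ rBk).
    apply: recursive_code_add => //.
      by apply: recursive_add (rh _); apply: rb _ _ (rb _ _ rk).
    exact: rb _ _ (rh _).
  have rk := rb _ _ (r4 _ _ (rb _ _ (rh 0))).
  have rBk := recursive_add rk (rh 2).
  apply: recursive_code_add => //; first exact: recursive_S.
  exact: rb _ _ (rh _).
have rBN2 := rb _ _ (rb _ _ rBN).
apply: recursive_code_add => //; first exact/rD/r4.
apply: recursive_code_add => //; [exact: rb _ _ (rb _ _ (r4 _ _ (rh _)))| exact/rD/r4|].
exact: rb _ _ (rh _).
Qed.

(** * The colours, and what they force *)

(** The components are the parity of the column, the kind of the vertex, and the
    incoming state and letter.  Recording what comes in, rather than what goes
    out, lets a vertex combine its two incoming edges, although a triple sees one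
    edge at a time. *)
Definition positive_part (M : transducer) : finType :=
  (bool * option bool * (state M * letter M))%type.

(** [None] is for negative vertices outside the chain.  The residue mod 3 is only
    there to keep neighbours along u different. *)
Definition colour (M : transducer) : finType := ('I_3 * option (positive_part M))%type.

Definition rule (M : transducer) (c : colour M) (l : tu) (c' : colour M) : bool :=
  match c.2, c'.2 with
  | None, None => if l is label_u then c.1 != c'.1 else true
  | None, Some (_, k', (_, a')) =>
      if l is label_u then (k' == None) && (a' == blank M) else false
  | Some _, None => false
  | Some (e, k, (q, a)), Some (e', k', (q', a')) =>
      if l is label_u then
        [&& c.1 != c'.1, k' == Some (e != e') & a' == letter_out k q a]
      else
        [&& e' == (k' == None) (+) e, q' == state_out k q a
          & ~~ ((k == None) && bad q)]
  end.

(** The classes are those that [chain_triples] expects. *)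
Definition class (M : transducer) (c : colour M) : nat :=
  match c.2 with
  | None => 1
  | Some (e, k, (q, a)) =>
      if (k == None) && (a == unit_letter M) then
        if ~~ e && (q == start M) then 2 else 3
      else 0
  end.

Definition colour_number (M : transducer) (c : colour M) : nat :=
  4 * enum_rank c + class c.

Lemma class_lt4 M (c : colour M) : class c < 4.
Proof.
by rewrite /class; case: c.2 => [[[e k] [q a]]|] //; case: ifP => // _; case: ifP.
Qed.

Lemma number_class M (c : colour M) d i : i < 4 -> colour_number c = 4 * d + i ->
  class c = i.
Proof.
have := class_lt4 c; rewrite /colour_number; move: (class c) (nat_of_ord _) => k r; lia.
Qed.

Lemma number_inj M : injective (@colour_number M).
Proof.
move=> c c' eq_cc; apply/enum_rank_inj/val_inj => /=.
have kE := number_class (class_lt4 c') eq_cc.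
by move: eq_cc; rewrite /colour_number kE => /addIn/eqP; rewrite eqn_pmul2l // => /eqP.
Qed.

Definition program_triples (M : transducer) : seq (nat * tu * nat) :=
  [seq (colour_number p.1.1, p.1.2, colour_number p.2)
  | p <- enum {: colour M * tu * colour M} & rule p.1.1 p.1.2 p.2].

Lemma mem_program_triples M a l b :
  reflect (exists c c' : colour M,
            [/\ a = colour_number c, b = colour_number c' & rule c l c'])
          ((a, l, b) \in program_triples M).
Proof.
apply: (iffP mapP) => [[[[c l'] c']]|[c [c' [-> -> r]]]].
  by rewrite mem_filter /= => /andP[r _] [-> -> ->]; exists c, c'.
by exists (c, l, c') => //; rewrite mem_filter /= r mem_enum.
Qed.

(** This number is the program, the input on which it is run, and an upper bound
    for the colours of the program. *)
Definition program_code M := CodeSeq.code (triple_word (program_triples M)).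

Lemma program_triples_lt M a l b : (a, l, b) \in program_triples M ->
  a < program_code M /\ b < program_code M.
Proof.
move=> ab; have /allP lt := CodeSeq.ltn_code (triple_word (program_triples M)).
by split; apply: lt; apply/flatten_mapP; exists (a, l, b); rewrite // !inE eqxx ?orbT.
Qed.

(** Every entry of a word is smaller than the code of the word, so it is enough
    to find each colour in some triple. *)
Lemma number_lt M (c : colour M) : colour_number c < program_code M.
Proof.
suff [c' r] : exists c', rule c label_u c'.
  have /program_triples_lt[] // : (colour_number c, label_u, colour_number c') \in program_triples M.
  by apply/mem_program_triples; exists c, c'.
have [r cr] : exists r : 'I_3, c.1 != r.
  by case: (eqVneq c.1 ord0) => [->|]; [exists ord_max | exists ord0].
case: c cr => r0 [[[e k] [q a]]|] /= rr; last by exists (r, None).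
exists (r, Some (e, Some false, (q, letter_out k q a))).
by rewrite /rule /= rr /= !eqxx.
Qed.

Lemma class1_None M (c : colour M) d : colour_number c = 4 * d + 1 -> c.2 = None.
Proof.
move/(@number_class M c d 1 isT).
by rewrite /class; case: c.2 => [[[e k] [q a]]|] //; do 2?case: ifP.
Qed.

(** Hence a positive vertex is followed by vertices of the program only. *)
Lemma chain_rule_number M a l b : chain_rule (program_code M) a l b ->
  forall c : colour M, a = colour_number c -> c.2 = None.
Proof.
move=> r c; have lt_c := number_lt c; move: lt_c.
case: r => [|d dx|d dx|k kN|k k' kN kk'|d k dx kN|d k i dx kN i23] lt_c cE;
  try lia; exact: class1_None (esym cE).
Qed.

Definition dyadic_colour M x n : colour M :=
  (inord (n %% 3), Some (odd (column n), kind_at n, (state_at M x n, letter_at M x n))).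

Definition allowed M a l b :=
  (a, l, b) \in chain_triples cons_triple (program_code M) (program_triples M).

Lemma allowedP M a l b : allowed M a l b <->
  chain_rule (program_code M) a l b \/
  exists c c' : colour M, [/\ a = colour_number c, b = colour_number c' & rule c l c'].
Proof.
rewrite /allowed mem_chain_triples.
by split; case=> [?|/mem_program_triples]; [left|right|left|right].
Qed.

Lemma allowed_positive M (c : colour M) l b : c.2 <> None -> allowed M (colour_number c) l b ->
  exists2 c', b = colour_number c' & rule c l c'.
Proof.
move=> cN /allowedP[/chain_rule_number-/(_ c erefl)//|[c0 [c' [/number_inj<- bE r]]]].
by exists c'.
Qed.

Lemma class_start M (c : colour M) : class c = 2 ->
  c.2 = Some (false, None, (start M, unit_letter M)).
Proof.
rewrite /class; case: c.2 => [[[e k] [q a]]|] //.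
by case: ifP => // /andP[/eqP-> /eqP->]; case: ifP => // /andP[/negPf-> /eqP->].
Qed.

Lemma class_power M (c : colour M) : 1 < class c ->
  exists e q, c.2 = Some (e, None, (q, unit_letter M)).
Proof.
rewrite /class; case: c.2 => [[[e k] [q a]]|] //.
by case: ifP => // /andP[/eqP-> /eqP->] _; exists e, q.
Qed.

Lemma mod3_neq s m : 0 < m ->
  (2 ^ s * (2 * m - 1)) %% 3 != (2 ^ s * (2 * m + 1)) %% 3.
Proof.
move=> m_gt0; rewrite eq_sym eqn_mod_dvd; last by rewrite leq_mul2l; lia.
rewrite -mulnBr (_ : _ - _ = 2); last lia.
by rewrite -expnSr Euclid_dvdX.
Qed.

Lemma inord3_neq m n : m %% 3 != n %% 3 -> inord (m %% 3) != inord (n %% 3) :> 'I_3.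
Proof. by apply: contra; rewrite inord_eq // -ltnS ltn_mod. Qed.

Lemma chain_rule_t x a b : chain_rule x a label_t b ->
  [\/ exists c, [/\ c < x, a = 4 * c + 1 & b = 4 * x + 2 ^ x],
      exists c, [/\ c < x, a = 4 * x & b = 4 * c + 2]
    | exists k, [/\ k < 2 ^ x, a = (4 * x + k).+1 & b = 4 * x + k]].
Proof.
move: {-1}label_t (erefl label_t) => l lE r; case: r lE => // [c cx|c cx|k kN] _.
- by constructor 1; exists c.
- by constructor 2; exists c.
- by constructor 3; exists k.
Qed.

Lemma chain_rule_u x a b : chain_rule x a label_u b ->
  [\/ a = 4 * x /\ b = 4 * x,
      exists k k', [/\ k' < k, k <= 2 ^ x, a = 4 * x + k & b = 4 * x + k'],
      exists c k, [/\ c < x, k <= 2 ^ x, a = 4 * c + 1 & b = 4 * x + k]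
    | exists c k i, [/\ c < x, a = 4 * x + k, b = 4 * c + i & i = 2 \/ i = 3]].
Proof.
move: {-1}label_u (erefl label_u) => l lE r.
case: r lE => // [|k k' kN kk'|c k cx kN|c k i cx kN i23] _.
- by constructor 1.
- by constructor 2; exists k, k'.
- by constructor 3; exists c, k.
- by constructor 4; exists c, k, i; split=> //; case/orP: i23 => /eqP; [left|right].
Qed.

(** The loop at 0 fixes the colour there; the t-line fixes the negative side down
    to -2^x, confines the rest of it to the colour class of negative vertices,
    and fixes the colour of 1.  From there on, strong induction along the
    positive vertices determines every colour up to its residue mod 3: the t-edge
    that enters a vertex gives its parity and state, the u-edge its kind and
    letter. *)
Lemma coloured_run M (f g : nat -> nat) :
  g 0 = f 0 -> allowed M (f 0) label_u (f 0) ->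
  (forall n, allowed M (f n) label_t (f n.+1) /\ allowed M (g n.+1) label_t (g n)) ->
  (forall s, allowed M (g (2 ^ s)) label_u (f (2 ^ s))) ->
  (forall s m, 0 < m ->
     allowed M (f (2 ^ s * (2 * m - 1))) label_u (f (2 ^ s * (2 * m + 1)))) ->
  forall i, ~~ bad (entering M (program_code M).+1 i).
Proof.
move=> gf0 loop Ht Hc Hu.
have xlt := @number_lt M; have aP := @allowedP M; have aB := @allowed_positive M.
move: (program_code M) xlt aP => x xlt aP.
have top_gt0 : 0 < 2 ^ x by rewrite expn_gt0.
have f0 : f 0 = 4 * x.
  move: loop => /aP[/chain_rule_u[[]//|[k [k' [h1 h2 h3 h4]]]|[c [k [h1 h2 h3 h4]]]
    |[c [k [i [h1 h2 h3 h4]]]]]|[c [c' [-> /number_inj<-]]]]; try lia.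
  by rewrite /rule; case: c.2 => [[[e k] [q a]]|]; rewrite eqxx.
have gchain k : k <= 2 ^ x -> g k = 4 * x + k.
  elim: k => [|k IHk] lt_k; first by rewrite gf0 f0 addn0.
  have := (Ht k).2; rewrite IHk ?(ltnW lt_k) //.
  case/aP=> [/chain_rule_t[[d [h1 h2 h3]]|[d [h1 h2 h3]]|[k' [h1 h2 h3]]]
    |[c [c' [_ cE _]]]]; try lia.
  by have := xlt c'; rewrite -cE; lia.
have gneg n : 2 ^ x < n -> exists c : colour M, g n = colour_number c /\ c.2 = None.
  move/subnKC => <-; elim: (n - _) => [|j [c [gE cN]]].
    rewrite addn0; have := (Ht (2 ^ x)).2; rewrite (gchain _ (leqnn (2 ^ x))).
    case/aP=> [/chain_rule_t[[d [h1 h2 h3]]|[d [h1 h2 h3]]|[k' [h1 h2 h3]]]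
      |[c [c' [_ cE _]]]]; try lia; last by have := xlt c'; rewrite -cE; lia.
    have := (Ht (2 ^ x).+1).2; rewrite h2.
    case/aP=> [/chain_rule_t[[d' [h1' h2' h3']]|[d' [h1' h2' h3']]|[k' [h1' h2' h3']]]
      |[c [c' [_ cE _]]]]; try lia.
    by exists c'; split; rewrite // (class1_None (esym cE)).
  rewrite addnS; have := (Ht ((2 ^ x).+1 + j)).2; rewrite gE; have := xlt c.
  move=> ltc /aP[/chain_rule_t[[d [h1 h2 h3]]|[d [h1 h2 h3]]|[k' [h1 h2 h3]]]
      |[c0 [c' [g0 /number_inj<- r]]]]; try lia.
    by move/(@number_class M c d 2 isT): h3; rewrite /class cN.
  by exists c0; split=> //; move: r; rewrite /rule cN; case: c0.2 => [[[? ?] [? ?]]|].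
have f1 : exists c : colour M, f 1 = colour_number c /\
    c.2 = Some (false, None, (start M, unit_letter M)).
  have := (Ht 0).1; rewrite f0.
  case/aP=> [/chain_rule_t[[d [h1 h2 h3]]|[d [h1 h2 h3]]|[k' [h1 h2 h3]]]
      |[c [c' [cE _ _]]]]; try lia; last by have := xlt c; rewrite -cE; lia.
  have := (Ht 1).1; rewrite h3.
  case/aP=> [/chain_rule_t[[d' [h1' h2' h3']]|[d' [h1' h2' h3']]|[k' [h1' h2' h3']]]
      |[c [c' [cE _ _]]]]; try lia.
  exists c; split=> //; apply: class_start.
  exact: (@number_class M c d 2 isT (esym cE)).
have fpos n : 0 < n -> exists r, f n = colour_number
    ((r, (dyadic_colour M x.+1 n).2) : colour M).
  elim/ltn_ind: n => -[//|n] IHn _.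
  case: n IHn => [|n] IHn.
    have [c [fE cE]] := f1; exists c.1; rewrite fE; congr colour_number.
    by rewrite [LHS]surjective_pairing cE; congr (_, Some _).
  have [r0 fr0] := IHn n.+1 (ltnSn _) isT.
  have := (Ht n.+1).1; rewrite fr0 => /aB[//|c fE rt].
  suff cE : c.2 = (dyadic_colour M x.+1 n.+2).2.
    by exists c.1; rewrite fE -cE -surjective_pairing.
  rewrite {1}/dyadic_colour [RHS]/(snd _).
  have cx := xlt c; case: c fE rt cx => r [[[e k] [q a]]|] //= fE.
  move=> /and3P[/eqP eE /eqP qE _] cx.
  rewrite state_out_at // in qE.
  have [o oo nE] := levelP (isT : 0 < n.+2).
  have [m oE] : exists m, o = 2 * m + 1.
    by exists o./2; rewrite -[LHS]odd_double_half oo mul2n addnC.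
  suff [kE aE] : k = kind_at n.+2 /\ a = letter_at M x.+1 n.+2.
    have -> : e = odd (column n.+2).
      by rewrite eE kE [RHS]parity_at // /kind_at; case: ifP.
    by rewrite kE qE aE.
  move: (level n.+2) nE => s nE; have [m0|m_gt0] := posnP m.
    (* The vertex is a power of 2: its u-predecessor is negative, and belongs to
       the chain if and only if s <= x. *)
    move: nE; rewrite oE m0 muln0 muln1 => nE.
    rewrite /kind_at /letter_at nE level_pow eqxx.
    have := Hc s; rewrite -nE fE; have s_gt0 : 0 < 2 ^ s by rewrite expn_gt0.
    have [le_sx|lt_xs] := leqP (2 ^ s) (2 ^ x).
      rewrite nE gchain // => /aP[/chain_rule_u[[h1 h2]|[k1 [k2 [h1 h2 h3 h4]]]
        |[d [k1 [h1 h2 h3 h4]]]|[d [k1 [i [h1 h2 h3 h4]]]]]|[c0 [c' [cE _ _]]]];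
        try lia.
        have cl : 1 < class ((r, Some (e, k, (q, a))) : colour M).
          by rewrite (@number_class M _ d i _ h3); case: h4 => ->.
        have [e' [q' /= [_ -> _ ->]]] := class_power cl.
        by rewrite /initial ltnS -(leq_exp2l _ _ (isT : 1 < 2)) le_sx.
      by have := xlt c0; lia.
    rewrite nE; have [c0 [-> c0N]] := gneg _ lt_xs.
    case/aP=> [/chain_rule_u[[h1 h2]|[k1 [k2 [h1 h2 h3 h4]]]
        |[d [k1 [h1 h2 h3 h4]]]|[d [k1 [i [h1 h2 h3 h4]]]]]|[c1 [c' [/number_inj<- /number_inj<- ru]]]];
        try by have := xlt c0; lia.
    move: ru; rewrite /rule c0N /= => /andP[/eqP-> /eqP->]; split=> //.
    rewrite /initial ltnS leqNgt; case: ifP => //; rewrite -leqNgt.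
    by rewrite -(leq_exp2l _ _ (isT : 1 < 2)) leqNgt lt_xs.
  (* The u-predecessor is positive, hence known by induction. *)
  have := upred_mul s m_gt0; rewrite -oE -nE => -[lE pE uE].
  have p_gt0 : 0 < 2 ^ s * (2 * m - 1) by rewrite muln_gt0 expn_gt0; lia.
  have lt_p : 2 ^ s * (2 * m - 1) < n.+2 by rewrite nE oE ltn_pmul2l ?expn_gt0; lia.
  have [r1 fp] := IHn _ lt_p p_gt0.
  have := Hu s m m_gt0; rewrite -oE -nE fE fp => /aB[//|c' /number_inj<-].
  rewrite /rule /= => /and3P[_ /eqP kE /eqP aE].
  rewrite /kind_at /letter_at lE pE uE kE aE letter_out_at // level_odd; last first.
    by rewrite subn1; case: (m) m_gt0 => // m' _; rewrite mulnS /= mul2n odd_double.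
  split=> //; congr (Some (_ != _)).
  by rewrite eE kE [RHS]parity_at // lE pE.
move=> i; have [r fr] := fpos (2 ^ i) (expn_gt0 2 i).
have := (Ht (2 ^ i)).1; rewrite fr => /aB[//|c' _].
rewrite /rule /= /kind_at /state_at level_pow eqxx column_pow /=.
by case: c' => r' [[[e k] [q a]]|] //= /and3P[].
Qed.

(** * Colouring a run, and undecidability *)

Definition negative_colour M n : colour M := (inord (n %% 3), None).

Lemma run_colours M (f g : nat -> nat) (x := program_code M) :
  (forall n, f n = if n is 0 then 4 * x else colour_number (dyadic_colour M x.+1 n)) ->
  (forall n, g n = if n <= 2 ^ x then 4 * x + n else colour_number (negative_colour M n)) ->
  (forall i, ~~ bad (entering M x.+1 i)) ->
  [/\ g 0 = f 0, allowed M (f 0) label_u (f 0),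
    forall n, allowed M (f n) label_t (f n.+1) /\ allowed M (g n.+1) label_t (g n),
    forall s, allowed M (g (2 ^ s)) label_u (f (2 ^ s))
  & forall s m, 0 < m ->
      allowed M (f (2 ^ s * (2 * m - 1))) label_u (f (2 ^ s * (2 * m + 1))) /\
      allowed M (g (2 ^ s * (2 * m + 1))) label_u (g (2 ^ s * (2 * m - 1)))].
Proof.
move=> fE gE good; have xlt (c : colour M) : colour_number c < x := number_lt c.
have chain a l b : chain_rule x a l b -> allowed M a l b.
  by move=> ?; apply/allowedP; left.
have prog (c c' : colour M) l : rule c l c' -> allowed M (colour_number c) l (colour_number c').
  by move=> ?; apply/allowedP; right; exists c, c'.
have fpos n : 0 < n -> f n = colour_number (dyadic_colour M x.+1 n) by rewrite fE; case: n.
have numE (c : colour M) : exists2 d, d < x & colour_number c = 4 * d + class c.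
  exists (enum_rank c) => //; have := xlt c; rewrite /colour_number.
  by move: (class c) (nat_of_ord _); lia.
split.
- by rewrite fE gE addn0.
- by rewrite fE; apply: chain; constructor.
- move=> n; split.
    have [->|n_gt0] := posnP n.
      rewrite fE (fpos 1) //; have [d dx ->] := numE (dyadic_colour M x.+1 1).
      rewrite (_ : class _ = 2); first by apply: chain; constructor.
      rewrite /class /dyadic_colour /= /kind_at /state_at /letter_at.
      by rewrite (level_pow 0 : level 1 = 0) /initial /= !eqxx.
    rewrite !fpos //; apply: prog; rewrite /rule /dyadic_colour /=.
    have kN k : (kind_at k == None) = (k == 2 ^ level k).
      by rewrite /kind_at; case: ifP.
    rewrite state_out_at // !kN parity_at // !eqxx /=.
    case: (boolP (n == _)) => //= n_pow; rewrite /state_at n_pow.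
    exact: good.
  have [|lt_n|->] := ltngtP n (2 ^ x).
  + move=> lt_n; rewrite !gE lt_n ltnW // addnS.
    by apply: chain; apply: chain_step.
  + rewrite !gE leqNgt ltnS ltnW // leqNgt lt_n /=.
    exact: prog.
  + rewrite !gE ltnn leqnn; have [d dx ->] := numE (negative_colour M (2 ^ x).+1).
    by apply: chain; apply: chain_enter.
- move=> s; rewrite fpos ?expn_gt0 // gE leq_exp2l //.
  have [le_sx|lt_xs] := leqP s x.
    have [d dx ->] := numE (dyadic_colour M x.+1 (2 ^ s)).
    apply/chain/chain_out; rewrite ?leq_exp2l //.
    rewrite /class /dyadic_colour /= /kind_at /letter_at level_pow eqxx.
    by rewrite /initial ltnS le_sx !eqxx /=; case: ifP.
  apply: prog; rewrite /rule /dyadic_colour /= /kind_at /letter_at level_pow.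
  by rewrite !eqxx /= /initial ltnS leqNgt lt_xs eqxx.
move=> s m m_gt0; have p_gt0 : 0 < 2 ^ s * (2 * m - 1).
  by rewrite muln_gt0 expn_gt0; lia.
have lt_p : 2 ^ s * (2 * m - 1) < 2 ^ s * (2 * m + 1).
  by rewrite ltn_pmul2l ?expn_gt0; lia.
have m3 := mod3_neq s m_gt0; have [lE pE uE] := upred_mul s m_gt0.
split.
  rewrite !fpos //; last exact: ltn_trans lt_p.
  apply: prog; rewrite /rule /dyadic_colour /= inord3_neq // letter_out_at //.
  rewrite /kind_at /letter_at lE pE uE eqxx level_odd ?eqxx //.
  by rewrite subn1; case: (m) m_gt0 => // m' _; rewrite mulnS /= mul2n odd_double.
rewrite !gE; case: leqP => [le_a|lt_a].
  by rewrite ifT; [apply/chain/chain_jump | apply: ltnW; apply: leq_trans le_a].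
case: leqP => [le_b|lt_b].
  have [d dx ->] := numE (negative_colour M (2 ^ s * (2 * m + 1))).
  by apply/chain/chain_in.
by apply: prog; rewrite /rule /= inord3_neq // eq_sym.
Qed.

Definition domino_of M : domino_instance tu :=
  let x := program_code M in
  instance (4 * x + 2 ^ x) (chain_triples cons_triple x (program_triples M)).

Lemma program_triples_le M : colours_le (program_code M) (program_triples M).
Proof. by case=> [[a l] b] /program_triples_lt[? ?]; split; apply: ltnW. Qed.

Lemma domino_of_code M : domino_code (domino_of M) = chain_code (program_code M).
Proof.
rewrite instance_code; first exact: chain_codeE.
exact/chain_triples_le/program_triples_le.
Qed.

Lemma domino_of_tileable M :
  tileable long_range_graph [set p in triples (domino_of M)] <->
  forall i, ~~ bad (entering M (program_code M).+1 i).
Proof.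
rewrite instance_tileable; last exact/chain_triples_le/program_triples_le.
rewrite (long_range_colouring (allowed M)); split.
  case=> f [g [gf loop Ht Hc Hu]]; apply: coloured_run gf loop Ht Hc _ => s m m_gt0.
  by have [] := Hu s m m_gt0.
move=> good; pose x := program_code M.
pose f n := if n is 0 then 4 * x else colour_number (dyadic_colour M x.+1 n).
pose g n := if n <= 2 ^ x then 4 * x + n else colour_number (negative_colour M n).
by exists f, g; apply: run_colours.
Qed.

(** Diagonalisation: [M] is run on the code of its own triples, with the claimed
    decision procedure applied to the resulting instance. *)
Theorem theorem2 : ~ domino_decidable long_range_graph.
Proof.
case=> f [rf decf].
pose d (v : 1.-tuple nat) := f [tuple chain_code (thead v)].
have rd : recursive d.
  apply: (rec_comp rf (fun _ : 'I_1 => recursive_chain_code)) => v.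
  by congr f; apply: eq_from_tnth => i; rewrite tnth_mktuple (tnth_nth 0) /=; case: i => -[].
have [M HM] := transducer_decides rd.
have [yes no] := decf (domino_of M).
rewrite domino_of_code in yes no.
have dE : d [tuple program_code M] = f [tuple chain_code (program_code M)] by [].
have iff := HM (program_code M); rewrite dE in iff.
have nt : ~ tileable long_range_graph [set p in triples (domino_of M)].
  by move=> t; move/domino_of_tileable/iff: (t); rewrite (yes t).
exact/nt/domino_of_tileable/iff/no.
Qed.
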